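(* Let $K$ be an algebraically closed field and let $A$ be a finitely generated $K$-algebra that is a domain with $\mathrm{GKdim}(A)<3$, with quotient division algebra $Q(A)$. If $D$ is a division $K$-subalgebra of $Q(A)$, then either $D$ is commutative or $Q(A)$ is finite dimensional as a left $D$-vector space. Moreover, if $D$ is commutative and has transcendence degree at least $2$ over $K$, then $Q(A)$ is finite dimensional over its centre.
   Context: For a finitely generated $K$-algebra $A$, $\mathrm{GKdim}(A)=\limsup_{n\to\infty}\log\dim_K(V^n)/\log n$, where $V$ is any finite-dimensional subspace containing $1$ that generates $A$ as a $K$-algebra. A finitely generated domain of finite GK dimension is an Ore domain and has a quotient division algebra $Q(A)$. *)

(* Defs.v *)
From HB Require Import structures.
From mathcomp Require Import all_boot all_order all_algebra.
From mathcomp Require Import boolp classical_sets reals ereal sequences exp.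
From mathcomp Require Import Rstruct.
Set Implicit Arguments. Unset Strict Implicit. Unset Printing Implicit Defensive.
Import Order.TTheory GRing.Theory Num.Theory.
Local Open Scope ring_scope.

Section Defs.
Variables (K : fieldType) (Q : unitAlgType K).

Definition in_span (vs : seq Q) (x : Q) : Prop :=
  exists c : seq K, x = \sum_(i < size vs) c`_i *: vs`_i.

Definition lin_free (vs : seq Q) : Prop :=
  forall c : seq K, \sum_(i < size vs) c`_i *: vs`_i = 0 ->
    forall i, (i < size vs)%N -> c`_i = 0.

Definition span_dim (vs : seq Q) : nat :=
  \max_(m : (size vs).-tuple bool | `[< lin_free (mask m vs) >]) size (mask m vs).

(* all products of n elements of the list 1 :: s; their span is V^n,
   where V = span(1 :: s) *)
Fixpoint words (s : seq Q) (n : nat) : seq Q :=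
  if n is n'.+1 then [seq x * y | x <- 1 :: s, y <- words s n'] else [:: 1].

Definition gen_alg (s : seq Q) : {pred Q} :=
  fun x => `[< exists n, in_span (words s n) x >].

Definition GKdim_gen (s : seq Q) : \bar Rdefinitions.R :=
  limn_esup (fun n => ((ln (span_dim (words s n))%:R) / ln n%:R)%:E).

Definition is_quotient_ring (A : {pred Q}) : Prop :=
  forall q : Q, exists a b, [/\ a \in A, b \in A, b != 0 & q = a / b].

Definition left_findim (S : {pred Q}) : Prop :=
  exists b : seq Q, forall q : Q, exists c : seq Q,
    all (mem S) c /\ q = \sum_(i < size b) c`_i * b`_i.

Definition centre : {pred Q} := fun z => `[< forall w : Q, z * w = w * z >].

Definition commutative_set (S : {pred Q}) : Prop :=
  {in S &, forall x y, x * y = y * x}.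

Definition alg_indep2 (x y : Q) : Prop :=
  forall (n : nat) (c : 'I_n -> 'I_n -> K),
    \sum_(i < n) \sum_(j < n) c i j *: (x ^+ i * y ^+ j) = 0 ->
    forall i j, c i j = 0.

Definition trdeg_ge2 (S : {pred Q}) : Prop :=
  exists x y, [/\ x \in S, y \in S & alg_indep2 x y].

End Defs.

(* Main.v *)
(* Let [V] be the span of 1 and the generators, and let [x] in [D] be transcendental over [K].
   Some [c] is such that [r] elements of [V^n] which are left free over [K(x)] force
   [dim V^(n + c) >= dim V^n + r].  Growth below [n^3] gives arbitrarily large [m] with
   [dim V^(m + c) - dim V^m = O(dim V^m / m)], so that a linear system yields a nonzero [z] with
   [t_j z] in [V^m] for about [m] words [t_j], closed under suffixes, in a finite subset of [D].
   If [Q] is not finite over [D], there are also [u_i] in [V^i], [i <= m], with the [z u_i] left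
   free over [D].  When the [t_j] are free over [K(x)], the products [t_j z u_i] are about [m^2]
   free elements of [V^(2m)]; hence [dim V^((2 + c)m)] is at least of order [m^3], a contradiction.

   If [D] is commutative of transcendence degree at least 2, the words [y^j] are free, so [Q] is
   finite over a commutative subfield and therefore over its centre.
   If [a], [b] in [D] do not commute, then for [x = a] there are free words in [a] and [b], or in
   finitely many [b a^l], unless [a] and [b] lie in a division algebra finite over [K(a)].  That is
   excluded by Tsen's argument: the determinant of right multiplication, over a maximal subfield,
   takes values in the centre, so it amounts to [M] forms in at least [M + 2] coordinates, which
   have a nontrivial common zero over an algebraically closed field. *)
Require Import Defs.
From HB Require Import structures.
From mathcomp Require Import all_boot all_order all_algebra.
From mathcomp Require Import boolp perm zify ring lra.
From mathcomp Require mpoly.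
Set Implicit Arguments. Unset Strict Implicit. Unset Printing Implicit Defensive.
Import Order.TTheory GRing.Theory Num.Theory.
Local Open Scope ring_scope.

(** * Linear algebra over a division subring *)

(** The obstacle is that [D] consists of fractions: multiplying a long word in elements of [D] into
    the filtration would cost a denominator per letter. Instead, one left denominator b in V^c is
    fixed for [x] and all letters, and each word gets its own unknown vector and one linear equation
    with values in V^(c + m), linking it to the vector of its suffix. With d(n) = dim V^n, a further
    word then costs only d(c + m) - d(m) unknowns, which is why the increments of d matter. The same
    device, applied to a Horner scheme, gives the lower bound for the growth.

    GK dimension below 3 enters twice: as d(n) = o(n^3) in the final count, and as m (d(m + c) -
    d(m)) <= 15 c d(m) for arbitrarily large m. The constant 15 is 2^4 - 1, from (1 + u)^4 <= 1 + 15
    u on [0, 1]. The second form also supplies the left denominators. *)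

Section LeftKernel.
Variables (R : unitRingType) (S : {pred R}).
Hypotheses (Scl : GRing.divring_closed S)
           (Sdiv : forall x, x \in S -> x != 0 -> x \is a GRing.unit).

Lemma divring0 : 0 \in S.
Proof. by case: Scl => S1 SB _; rewrite -(subrr 1) SB. Qed.

Lemma divring1 : 1 \in S.
Proof. by case: Scl. Qed.

Lemma divringN x : x \in S -> - x \in S.
Proof. by case: Scl => _ SB _ Sx; rewrite -sub0r SB ?divring0. Qed.

Lemma divringD x y : x \in S -> y \in S -> x + y \in S.
Proof. by case: (Scl) => _ SB _ Sx Sy; rewrite -(opprK y) SB ?divringN. Qed.

Lemma divringV x : x \in S -> x^-1 \in S.
Proof. by case: (Scl) => _ _ SV Sx; rewrite -[_^-1]mul1r SV ?divring1. Qed.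

Lemma divringM x y : x \in S -> y \in S -> x * y \in S.
Proof. by case: (Scl) => _ _ SV Sx Sy; rewrite -(invrK y) SV ?divringV. Qed.

Lemma divring_sum (I : Type) (r : seq I) (P : pred I) (F : I -> R) :
  (forall i, P i -> F i \in S) -> \sum_(i <- r | P i) F i \in S.
Proof. by move=> FS; elim/big_rec: _ => [|i x Pi Sx]; rewrite ?divring0 ?divringD ?FS. Qed.

(** Gaussian elimination with coefficients on the left: a pivot row [i0] clears the first column in
    the other rows, induction treats the remaining columns, and the coefficient of the pivot row is
    then forced. *)
Let left_kernel_ord n m (A : 'I_m -> 'I_n -> R) :
  (forall i e, A i e \in S) -> (n < m)%N ->
  exists a : 'I_m -> R, [/\ forall i, a i \in S, exists i, a i != 0
    & forall e, \sum_i a i * A i e = 0].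
Proof.
elim: n m A => [|n IH] [|m] A AS // ltnm.
  exists (fun=> 1); split=> [i||[]//]; first exact: divring1.
  by exists ord0; rewrite oner_neq0.
have [/existsP[i0 Ai0]|/existsPn A0] := boolP [exists i, A i ord0 != 0]; last first.
  have [] := IH m.+1 (fun i e => A i (lift ord0 e)) _ _ => [i e||a [aS a0 aA]]; rewrite ?AS //.
    exact: ltn_trans ltnm.
  exists a; split=> // e; case: (unliftP ord0 e) => [j|] ->; first exact: aA.
  by rewrite big1 // => i _; rewrite (eqP (negPn (A0 i))) mulr0.
pose B (i : 'I_m) (e : 'I_n) :=
  A (lift i0 i) (lift ord0 e) - A (lift i0 i) ord0 * (A i0 ord0)^-1 * A i0 (lift ord0 e).
have [i e||a [aS [i1 a0] aB]] := IH m B _ _ => //.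
  by rewrite divringD ?divringN ?divringM ?divringV ?AS.
pose a' i := if unlift i0 i is Some j then a j
  else - \sum_j a j * A (lift i0 j) ord0 * (A i0 ord0)^-1.
have a'0 : a' i0 = - \sum_j a j * A (lift i0 j) ord0 * (A i0 ord0)^-1.
  by rewrite /a' unlift_none.
have a'1 j : a' (lift i0 j) = a j by rewrite /a' liftK.
have sumE e : \sum_i a' i * A i e =
    \sum_j a j * A (lift i0 j) e - \sum_j a j * A (lift i0 j) ord0 * (A i0 ord0)^-1 * A i0 e.
  rewrite (bigD1_ord i0) //= a'0 mulNr mulr_suml addrC; congr (_ - _).
  by apply: eq_bigr => j _; rewrite a'1.
exists a'; split.
- move=> i; case: (unliftP i0 i) => [j|] ->; rewrite ?a'1 ?aS // a'0.
  by rewrite divringN ?divring_sum // => j _; rewrite !divringM ?divringV ?AS ?aS.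
- by exists (lift i0 i1); rewrite a'1.
move=> e; rewrite sumE; case: (unliftP ord0 e) => [k|] ->.
  rewrite -sumrB -[RHS](aB k); apply: eq_bigr => j _.
  by rewrite /B mulrBr !mulrA.
rewrite -sumrB big1 // => j _.
by rewrite mulrVK ?subrr //; apply: Sdiv; rewrite ?AS.
Qed.

Lemma left_kernel (I E : finType) (A : I -> E -> R) :
  (forall i e, A i e \in S) -> (#|E| < #|I|)%N ->
  exists a : I -> R, [/\ forall i, a i \in S, exists i, a i != 0
    & forall e, \sum_i a i * A i e = 0].
Proof.
move=> AS ltEI.
have [i e|a [aS [i1 a0] aA]] :=
  @left_kernel_ord _ _ (fun i e => A (enum_val i) (enum_val e)) _ ltEI.
  exact: AS.
exists (fun i => a (enum_rank i)); split=> [i||e]; first exact: aS.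
  by exists (enum_val i1); rewrite enum_valK.
rewrite -[RHS](aA (enum_rank e)) (reindex (fun i : 'I_#|I| => enum_val i)) /=; last first.
  by exists enum_rank => x _; rewrite ?enum_valK ?enum_rankK.
by apply: eq_bigr => i _; rewrite enum_valK enum_rankK.
Qed.

End LeftKernel.

Lemma sum_pairE (V : nmodType) (I J : finType) (F : I * J -> V) :
  \sum_p F p = \sum_i \sum_j F (i, j).
Proof. by rewrite pair_big; apply: eq_bigr => -[]. Qed.

Section LeftSpaces.
Variable R : unitRingType.
Hypothesis Rdiv : forall x : R, x != 0 -> x \is a GRing.unit.

Definition spn (S : {pred R}) (I : finType) (w : I -> R) (x : R) : Prop :=
  exists c : I -> R, (forall i, c i \in S) /\ x = \sum_i c i * w i.

Definition frl (S : {pred R}) (I : finType) (v : I -> R) : Prop :=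
  forall c : I -> R, (forall i, c i \in S) -> \sum_i c i * v i = 0 ->
  forall i, c i = 0.

Definition lspace (S : {pred R}) (X : R -> Prop) : Prop :=
  [/\ X 0, forall x y, X x -> X y -> X (x + y)
    & forall c x, c \in S -> X x -> X (c * x)].

(** [X] need not be a subspace: it is only asked to contain a free family whose span contains it.
    For an [lspace] this is a basis. *)
Definition fdim (S : {pred R}) (X : R -> Prop) (n : nat) : Prop :=
  exists v : 'I_n -> R, [/\ forall i, X (v i), frl S v
    & forall x, X x -> spn S v x].

Lemma divr_neq0 (x y : R) : x != 0 -> y != 0 -> x * y != 0.
Proof.
move=> x0 y0; apply: contra_neq x0 => xy0.
by rewrite -(mulrK (Rdiv y0) x) xy0 mul0r.
Qed.

Lemma divr_eq0 (x y : R) : x * y = 0 -> x = 0 \/ y = 0.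
Proof.
move=> xy0; have [->|x0] := eqVneq x 0; first by left.
have [->|y0] := eqVneq y 0; first by right.
by case/eqP: (divr_neq0 x0 y0).
Qed.

Lemma spn_reindex S (I J : finType) (h : J -> I) (w : I -> R) x :
  bijective h -> spn S w x -> spn S (w \o h) x.
Proof.
move=> bh [c [cS ->]]; exists (c \o h); split=> [i|] /=; first exact: cS.
by case: (bh) => h' hK h'K; rewrite (reindex h) //; exists h'=> i _.
Qed.

Lemma frl_reindex S (I J : finType) (h : J -> I) (w : I -> R) :
  bijective h -> frl S w -> frl S (w \o h).
Proof.
move=> bh fw c cS cw i; case: (bh) => h' hK h'K.
rewrite -(hK i); apply: (fw (c \o h')) => /= [j|]; first exact: cS.
rewrite (reindex h) /= -?[RHS]cw; last by exists h' => j _.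
by apply: eq_bigr => j _; rewrite hK.
Qed.

Lemma enum_val_bijective (I : finType) : bijective (fun i : 'I_#|I| => enum_val i : I).
Proof. by exists enum_rank => i; rewrite ?enum_valK ?enum_rankK. Qed.

Section Fixed.
Variable S : {pred R}.
Hypothesis Scl : GRing.divring_closed S.

Let Sdiv x : x \in S -> x != 0 -> x \is a GRing.unit.
Proof. by move=> _; exact: Rdiv. Qed.

Lemma spn_lspace (I : finType) (w : I -> R) : lspace S (spn S w).
Proof.
split.
- exists (fun=> 0); split=> [_|]; first exact: divring0.
  by rewrite big1 // => i _; rewrite mul0r.
- move=> x y [c [cS ->]] [d [dS ->]]; exists (fun i => c i + d i); split=> [i|].
    exact: divringD.
  by rewrite -big_split; apply: eq_bigr => i _; rewrite mulrDl.
move=> a x aS [c [cS ->]]; exists (fun i => a * c i); split=> [i|].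
  exact: divringM.
by rewrite mulr_sumr; apply: eq_bigr => i _; rewrite mulrA.
Qed.

Lemma lspace_sum X (I : Type) (r : seq I) (P : pred I) (c v : I -> R) :
  lspace S X -> (forall i, c i \in S) -> (forall i, P i -> X (v i)) ->
  X (\sum_(i <- r | P i) c i * v i).
Proof.
move=> [X0 XD XZ] cS Xv; elim/big_rec: _ => // i x Pi Xx.
by apply: XD => //; apply: XZ => //; apply: Xv.
Qed.

Lemma spn_sub X (I : finType) (w : I -> R) x :
  lspace S X -> (forall i, X (w i)) -> spn S w x -> X x.
Proof. by move=> lX Xw [c [cS ->]]; apply: lspace_sum. Qed.

Lemma spn_gen (I : finType) (w : I -> R) i : spn S w (w i).
Proof.
exists (fun j => (j == i)%:R); split=> [j|].
  by case: eqP => _; [apply: divring1|apply: divring0].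
rewrite (bigD1 i) //= eqxx mul1r big1 ?addr0 // => j /negbTE->.
by rewrite mul0r.
Qed.

Lemma frl_le_spn (I J : finType) (v : I -> R) (w : J -> R) :
  frl S v -> (forall i, spn S w (v i)) -> (#|I| <= #|J|)%N.
Proof.
move=> fv vw; rewrite leqNgt; apply/negP => ltJI.
have [A AP] := choice vw.
have [i j|a [aS [i a0] aA]] := left_kernel Scl Sdiv (A := A) _ ltJI.
  by case: (AP i).
case/eqP: a0; apply: (fv a aS); under eq_bigr => k _.
  rewrite (AP k).2 mulr_sumr; under eq_bigr => j _ do rewrite mulrA; over.
rewrite exchange_big big1 // => j _; rewrite -mulr_suml.
by rewrite aA mul0r.
Qed.

Definition extend n (v : 'I_n -> R) (x : R) (i : 'I_n.+1) : R :=
  if unlift ord_max i is Some j then v j else x.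

Lemma extend_max n (v : 'I_n -> R) x : extend v x ord_max = x.
Proof. by rewrite /extend unlift_none. Qed.

Lemma extend_lift n (v : 'I_n -> R) x i : extend v x (lift ord_max i) = v i.
Proof. by rewrite /extend liftK. Qed.

Lemma frl_extend n (v : 'I_n -> R) x :
  frl S v -> ~ spn S v x -> frl S (extend v x).
Proof.
move=> fv nx c cS; rewrite (bigD1_ord ord_max) //= extend_max.
under eq_bigr => i _ do rewrite extend_lift.
move=> e0; have [cm0|cm0] := eqVneq (c ord_max) 0.
  move: e0; rewrite cm0 mul0r add0r => e0 i.
  case: (unliftP ord_max i) => [j|] -> //.
  by apply: (fv (fun j => c (lift ord_max j))).
case: nx; exists (fun i => - ((c ord_max)^-1 * c (lift ord_max i))); split=> [i|].
  by rewrite divringN ?divringM ?divringV.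
under eq_bigr => i _ do rewrite mulNr -mulrA.
rewrite sumrN -mulr_sumr; move/eqP: e0; rewrite addrC addr_eq0 => /eqP->.
by rewrite mulrN opprK mulKr // Rdiv.
Qed.

Lemma frl_extend_all n (v : nat -> R) :
  (forall i, (i < n)%N -> ~ spn S (fun j : 'I_i => v j) (v i)) ->
  frl S (fun j : 'I_n => v j).
Proof.
elim: n => [|n IH] nv; first by move=> c cS _ [].
have fn : frl S (fun j : 'I_n => v j).
  by apply: IH => i lti; apply: nv; rewrite ltnS ltnW.
have := frl_extend fn (nv n (ltnSn _)); congr frl.
apply/funext => i; case: (unliftP ord_max i) => [j|] ->.
  by rewrite extend_lift lift_max.
by rewrite extend_max.
Qed.

Lemma frl_spn_inj n (v : 'I_n -> R) x m (w : 'I_m -> R) :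
  frl S v -> (forall i, spn S w (v i)) -> spn S w x -> (m <= n)%N -> spn S v x.
Proof.
move=> fv vw wx lemn; apply: contrapT => nx.
have /frl_le_spn := frl_extend fv nx; move/(_ _ w); rewrite !card_ord.
rewrite ltnNge lemn => H; suff: false by []; apply: H => i.
by case: (unliftP ord_max i) => [j|] ->; rewrite ?extend_lift ?extend_max.
Qed.

(** A free family in [X] of maximal size spans [X], since an element outside its span could be added
    to it. *)
Lemma fdim_bounded (X : R -> Prop) N :
  (forall n (v : 'I_n -> R), (forall i, X (v i)) -> frl S v -> (n <= N)%N) ->
  exists2 n, (n <= N)%N & fdim S X n.
Proof.
move=> bX.
pose P n := `[< exists v : 'I_n -> R, (forall i, X (v i)) /\ frl S v >].
have P0 : exists n, P n.
  exists 0%N; apply/asboolP; exists (fun=> 0); split=> [[]//|c _ _ []//].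
have Pb n : P n -> (n <= N)%N by move=> /asboolP[v [Xv fv]]; apply: bX Xv fv.
case: (ex_maxnP P0 Pb) => n /asboolP[v [Xv fv]] maxn.
exists n; first exact: bX Xv fv.
exists v; split=> // x Xx; apply: contrapT => nx.
suff /maxn : P n.+1 by rewrite ltnn.
apply/asboolP; exists (extend v x); split; last exact: frl_extend.
by move=> i; case: (unliftP ord_max i) => [j|] ->; rewrite ?extend_lift ?extend_max.
Qed.

Lemma fdim_spanned (X : R -> Prop) (J : finType) (w : J -> R) :
  (forall x, X x -> spn S w x) -> exists2 n, (n <= #|J|)%N & fdim S X n.
Proof.
move=> Xw; apply: fdim_bounded => n v Xv fv.
by rewrite -[n]card_ord; apply: (frl_le_spn fv) => i; apply: Xw.
Qed.

Lemma fdim_le (X : R -> Prop) n (I : finType) (v : I -> R) :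
  fdim S X n -> (forall i, X (v i)) -> frl S v -> (#|I| <= n)%N.
Proof.
move=> [w [_ _ Xw]] Xv fv; rewrite -[n]card_ord.
by apply: (frl_le_spn fv) => i; apply: Xw.
Qed.

Lemma fdim_uniq (X : R -> Prop) n m : fdim S X n -> fdim S X m -> n = m.
Proof.
move=> dn dm; apply/eqP; rewrite eqn_leq.
case: (dn) => v [Xv fv _]; case: (dm) => w [Xw fw _].
by have := fdim_le dm Xv fv; have := fdim_le dn Xw fw; rewrite !card_ord => -> ->.
Qed.

Lemma fdim_full (X : R -> Prop) n (v : 'I_n -> R) x :
  fdim S X n -> (forall i, X (v i)) -> frl S v -> X x -> spn S v x.
Proof.
move=> [w [_ _ Xw]] Xv fv Xx.
by apply: (frl_spn_inj fv (w := w)) => // [i|]; apply: Xw.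
Qed.

Lemma frl_mulr (I : finType) (v : I -> R) a :
  a != 0 -> frl S v -> frl S (fun i => v i * a).
Proof.
move=> a0 fv c cS; under eq_bigr => i _ do rewrite mulrA.
rewrite -mulr_suml => /divr_eq0[|/eqP]; last by rewrite (negbTE a0).
exact: fv.
Qed.

(* Right multiplication is an injective, hence bijective, map of a finite
   dimensional left space. *)
Lemma fdim_mulr_onto (X : R -> Prop) n a x :
  lspace S X -> fdim S X n -> a != 0 -> (forall y, X y -> X (y * a)) ->
  X x -> X (x / a).
Proof.
move=> lX dX a0 Xa Xx; case: (dX) => v [Xv fv Xs].
have Xva i : X (v i * a) by apply: Xa.
have [c [cS ->]] := fdim_full dX Xva (frl_mulr a0 fv) Xx.
rewrite mulr_suml; under eq_bigr => i _ do rewrite -mulrA mulrK ?Rdiv //.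
exact: lspace_sum.
Qed.

End Fixed.

Lemma fdim_tower (S T : {pred R}) (X : R -> Prop) l m :
  GRing.divring_closed S -> GRing.divring_closed T ->
  (forall c, c \in S -> c \in T) ->
  lspace T X -> fdim S (fun x => x \in T) l -> fdim T X m -> fdim S X (l * m)%N.
Proof.
move=> Scl Tcl ST lX [u [uT fu us]] [v [Xv fv vs]].
pose w (p : 'I_l * 'I_m) := u p.1 * v p.2.
have fw : frl S w.
  move=> c cS; rewrite sum_pairE exchange_big /=.
  under eq_bigr => j _.
    under eq_bigr => i _ do rewrite /w /= mulrA.
    rewrite -mulr_suml; over.
  move/fv => c0 [i j]; apply: (fu (fun i => c (i, j))) => [k|]; first exact: cS.
  by apply: c0 => k; apply: (divring_sum Tcl) => a _; rewrite (divringM Tcl) ?uT ?ST ?cS.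
have ws x : X x -> spn S w x.
  move/vs => [c [cT ->]]; have /choice[d dP] : forall j, exists d : 'I_l -> R,
    (forall i, d i \in S) /\ c j = \sum_i d i * u i by move=> j; apply: us; apply: cT.
  exists (fun p => d p.2 p.1); split=> [p|]; first by case: (dP p.2).
  rewrite sum_pairE exchange_big /=.
  apply: eq_bigr => j _; rewrite {1}(dP j).2 mulr_suml.
  by apply: eq_bigr => i _; rewrite /w /= mulrA.
have -> : (l * m)%N = #|{: 'I_l * 'I_m}| by rewrite card_prod !card_ord.
exists (w \o (fun i => enum_val i)); split=> [i||x Xx] /=.
- by case: lX => _ _ XZ; apply: XZ.
- by apply: frl_reindex => //; apply: enum_val_bijective.
- by apply: spn_reindex => //; [apply: enum_val_bijective|apply: ws].
Qed.

End LeftSpaces.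

(** * Subalgebras and centralizers *)

Section Subalgebras.
Variables (K : fieldType) (Q : unitAlgType K).
Hypothesis Qdiv : forall x : Q, x != 0 -> x \is a GRing.unit.

Lemma divalgZ (D : {pred Q}) (k : K) x : divalg_closed D -> x \in D -> k *: x \in D.
Proof.
move=> Dcl Dx; case: (Dcl) => _ DL _; rewrite -[_ *: _]addr0 DL //.
exact: (divring0 Dcl).
Qed.

Lemma divalgA (D : {pred Q}) (k : K) : divalg_closed D -> k%:A \in D.
Proof. by move=> Dcl; apply: divalgZ => //; exact: (divring1 Dcl). Qed.

Lemma divalgX (D : {pred Q}) x n : divalg_closed D -> x \in D -> x ^+ n \in D.
Proof.
move=> Dcl Dx; elim: n => [|n IH]; first exact: (divring1 Dcl).
by rewrite exprS (divringM Dcl).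
Qed.

Lemma divalg_closedP (D : {pred Q}) :
  1 \in D -> (forall k x, x \in D -> k *: x \in D) ->
  (forall x y, x \in D -> y \in D -> x + y \in D) ->
  (forall x y, x \in D -> y \in D -> x * y \in D) ->
  (forall x, x \in D -> x != 0 -> x^-1 \in D) -> divalg_closed D.
Proof.
move=> D1 DZ DD DM DV; split=> // [k x y Dx Dy|x y Dx Dy]; first exact/DD/Dy/DZ.
have [->|y0] := eqVneq y 0; last by apply: DM => //; apply: DV.
by rewrite invr0 mulr0 -(scale0r 1) DZ.
Qed.

Definition kscal : {pred Q} := fun x => `[< exists k : K, x = k%:A >].

Lemma kscalP x : reflect (exists k : K, x = k%:A) (x \in kscal).
Proof. exact: asboolP. Qed.

Lemma kscal_divalg : divalg_closed kscal.
Proof.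
apply: divalg_closedP => [|k x|x y|x y|x].
- by apply/kscalP; exists 1; rewrite scale1r.
- by move=> /kscalP[a ->]; apply/kscalP; exists (k * a); rewrite scalerA.
- by move=> /kscalP[a ->] /kscalP[b ->]; apply/kscalP; exists (a + b); rewrite scalerDl.
- by move=> /kscalP[a ->] /kscalP[b ->]; apply/kscalP; exists (a * b); rewrite mulr_algl scalerA.
move=> /kscalP[a ->] a0; apply/kscalP; exists a^-1.
by rewrite invrZ ?unitr1 ?invr1 // unitfE; apply: contraNneq a0 => ->; rewrite scale0r.
Qed.

Definition centz (D A : {pred Q}) : {pred Q} :=
  fun x => (x \in D) && `[< forall y, y \in A -> x * y = y * x >].

Lemma centzP (D A : {pred Q}) x :
  reflect (x \in D /\ forall y, y \in A -> x * y = y * x) (x \in centz D A).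
Proof. by apply: (iffP andP) => -[Dx /asboolP]. Qed.

Lemma commV (x y : Q) : x * y = y * x -> x^-1 * y = y * x^-1.
Proof. by move=> xy; apply/esym/commrV. Qed.

Lemma centz_divalg (D A : {pred Q}) : divalg_closed D -> divalg_closed (centz D A).
Proof.
move=> Dcl; apply: divalg_closedP => [|k x|x y|x y|x].
- by apply/centzP; split=> [|y _]; rewrite ?mul1r ?mulr1 // (divring1 Dcl).
- move=> /centzP[Dx cx]; apply/centzP; split=> [|y Ay]; first exact: divalgZ.
  by rewrite -scalerAl -scalerAr cx.
- move=> /centzP[Dx cx] /centzP[Dy cy]; apply/centzP; split=> [|z Az].
    exact: (divringD Dcl).
  by rewrite mulrDl mulrDr cx ?cy.
- move=> /centzP[Dx cx] /centzP[Dy cy]; apply/centzP; split=> [|z Az].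
    exact: (divringM Dcl).
  by rewrite -mulrA cy // mulrA cx // mulrA.
move=> /centzP[Dx cx] x0; apply/centzP; split=> [|z Az]; first exact: (divringV Dcl).
exact/commV/cx.
Qed.

(** The shortest-relation argument, shared by [two_sided_free] and [centralizer_codim_le]. Scaling
    one entry to 1 makes that entry of a commutator such as y w - w y vanish, and minimality then
    kills the whole commutator. *)
Lemma min_support (D : {pred Q}) (I : finType) (P : (I -> Q) -> Prop) :
  divalg_closed D ->
  (forall y, P y -> forall i, y i \in D) ->
  (forall c y, c \in D -> P y -> P (fun i => c * y i)) ->
  (exists y, P y /\ exists i, y i != 0) ->
  exists y i0, [/\ P y, y i0 = 1 & forall z, P z -> (forall i, y i = 0 -> z i = 0) ->
    z i0 = 0 -> forall i, z i = 0].
Proof.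
move=> Dcl PD PM [y1 Py1].
pose N n := `[< exists y, [/\ P y, exists i, y i != 0 & #|[pred i | y i != 0]| = n] >].
have exN : exists n, N n.
  by exists #|[pred i | y1 i != 0]|; apply/asboolP; exists y1; case: Py1.
case: (ex_minnP exN) => n /asboolP[y [Py [i0 yi0] yn]] minn.
exists (fun i => (y i0)^-1 * y i), i0; split.
- by apply: PM => //; apply: (divringV Dcl); apply: PD.
- by rewrite mulVr // Qdiv.
move=> z Pz zy zi0 i; apply: contrapT => /eqP zi.
have /minn : N #|[pred i | z i != 0]|.
  by apply/asboolP; exists z; split=> //; exists i.
rewrite leqNgt -yn => /negP; apply; apply: proper_card; apply/properP; split.
  by apply/subsetP => j; rewrite !inE; apply: contra_neq => yj; rewrite zy // yj mulr0.
by exists i0; rewrite !inE ?zi0 ?eqxx.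
Qed.

(** The tensor product of [D] and its opposite over the centre acts faithfully on [D] by x -> l x q.
    In a shortest relation with one entry 1, commutators with elements of [D] vanish, so all entries
    are central; x = 1 then contradicts the freeness of [q]. *)
Lemma two_sided_free (D : {pred Q}) (I : finType) (q l : I -> Q) :
  divalg_closed D -> (forall i, q i \in D) -> frl (centz D D) q ->
  (forall i, l i \in D) -> (forall x, x \in D -> \sum_i l i * x * q i = 0) ->
  forall i, l i = 0.
Proof.
move=> Dcl qD fq lD lx; apply: contrapT => /existsNP[i1 li1].
pose P (l : I -> Q) := (forall i, l i \in D) /\
  (forall x, x \in D -> \sum_i l i * x * q i = 0).
have [|||y [i0 [[yD yx] y1 ymin]]] := @min_support D I P Dcl.
- by move=> y [].
- move=> c y cD [yD yx]; split=> [i|x Dx]; first exact: (divringM Dcl).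
  under eq_bigr => i _ do rewrite -!mulrA mulrA.
  rewrite -[RHS](mulr0 c) -[in RHS](yx x Dx) mulr_sumr.
  by apply: eq_bigr => i _; rewrite !mulrA.
- by exists l; split=> //; exists i1; apply/eqP.
have yC i : y i \in centz D D.
  apply/centzP; split=> // w Dw; apply/eqP; rewrite -subr_eq0; apply/eqP.
  apply: (ymin (fun i => y i * w - w * y i)) => [|j ->|]; last first.
  - by rewrite y1 mul1r mulr1 subrr.
  - by rewrite mul0r mulr0 subrr.
  split=> [j|x Dx].
    by rewrite (divringD Dcl) ?(divringN Dcl) ?(divringM Dcl).
  under eq_bigr => j _ do rewrite !mulrBl -(mulrA (y j)) -!(mulrA w).
  by rewrite sumrB -mulr_sumr !yx ?(divringM Dcl) // mulr0 subrr.
have /(fq y yC)/(_ i0)/eqP : \sum_i y i * q i = 0.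
  by rewrite -[RHS](yx 1 (divring1 Dcl)); apply: eq_bigr => i _; rewrite mulr1.
by rewrite y1 oner_eq0.
Qed.

(** Given more than n^2 elements q_i free over the centre, the n^2 coordinates over [L] of the
    products e_j q_i leave a nonzero solution of sum_i l_i e_j q_i = 0 for all j. As [L] is
    commutative, this extends from the basis to sum_i l_i x q_i = 0 for all x in [D], against
    [two_sided_free]. *)
Lemma centre_fdim (D L : {pred Q}) n :
  divalg_closed D -> divalg_closed L -> (forall x, x \in L -> x \in D) ->
  commutative_set L -> fdim L (fun x => x \in D) n ->
  exists2 r, (r <= n * n)%N & fdim (centz D D) (fun x => x \in D) r.
Proof.
move=> Dcl Lcl LD Lcomm [e [eD fe es]].
apply: fdim_bounded => // [|k q qD fq]; first exact: centz_divalg.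
rewrite leqNgt; apply/negP => ltk.
have /choice[A AP] : forall i : 'I_k, exists A : 'I_n * 'I_n -> Q, forall j,
    (forall t, A (j, t) \in L) /\ e j * q i = \sum_t A (j, t) * e t.
  move=> i; have /choice[A AP] : forall j, exists A : 'I_n -> Q,
      (forall t, A t \in L) /\ e j * q i = \sum_t A t * e t.
    by move=> j; apply: es; rewrite (divringM Dcl).
  by exists (fun p => A p.1 p.2).
have [||l [lL [i1 li1] lA]] := left_kernel Lcl (fun x _ => @Qdiv x) (A := A).
- by move=> i [j t]; case: (AP i j).
- by rewrite card_prod !card_ord.
have le j : \sum_i l i * e j * q i = 0.
  under eq_bigr => i _.
    rewrite -mulrA (AP i j).2 mulr_sumr; under eq_bigr => t _ do rewrite mulrA; over.
  rewrite exchange_big big1 // => t _; rewrite -mulr_suml.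
  by rewrite (lA (j, t)) mul0r.
case/eqP: li1; apply: (two_sided_free Dcl qD fq) => [i|x /es[c [cL ->]]].
  exact: LD.
under eq_bigr => i _.
  rewrite mulr_sumr mulr_suml.
  under eq_bigr => j _ do rewrite mulrA (Lcomm _ _ (lL i) (cL j)) -!mulrA; over.
rewrite exchange_big big1 // => j _; rewrite -mulr_sumr.
by under eq_bigr => i _ do rewrite mulrA; rewrite le mulr0.
Qed.

(* Artin's argument, with the commutation with [d] in place of a group of automorphisms. *)
Lemma centralizer_codim_le (D : {pred Q}) d m e (v : 'I_m -> Q) :
  divalg_closed D -> d \in D -> (forall i, v i \in D) ->
  frl (centz D (pred1 d)) v ->
  spn (centz D D) (fun j : 'I_e => d ^+ j) (d ^+ e) -> (m <= e)%N.
Proof.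
move=> Dcl dD vD fv [c [cC de]]; rewrite leqNgt; apply/negP => ltem.
have e0 : (0 < e)%N.
  by case: e c cC de ltem => // c _ /eqP; rewrite expr0 big_ord0 oner_eq0.
pose P (y : 'I_m -> Q) := (forall i, y i \in D) /\
  (forall j : 'I_e, \sum_i y i * (d ^+ j * v i) = 0).
have [|||y [i0 [[yD yv] y1 ymin]]] := @min_support D _ P Dcl.
- by move=> y [].
- move=> a y aD [yD yv]; split=> [i|j]; first exact: (divringM Dcl).
  by under eq_bigr => i _ do rewrite -mulrA; rewrite -mulr_sumr yv mulr0.
- have [||y [yD y0 yv]] := left_kernel Dcl (fun x _ => @Qdiv x)
    (A := fun (i : 'I_m) (j : 'I_e) => d ^+ j * v i).
  + by move=> i j; rewrite (divringM Dcl) ?divalgX.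
  + by rewrite !card_ord.
  by exists y.
(* As d^e is a central combination of lower powers, the relation holds for the exponent e too. This
   is what lets the commutator with [d] satisfy [P] at j = e - 1. *)
have yve : \sum_i y i * (d ^+ e * v i) = 0.
  rewrite de; under eq_bigr => i _.
    rewrite mulr_suml mulr_sumr.
    under eq_bigr => j _.
      have /centzP[_ cj] := cC j.
      rewrite -mulrA mulrA -cj // -mulrA; over.
    over.
  by rewrite exchange_big big1 // => j _; rewrite -mulr_sumr yv mulr0.
have yM i : y i \in centz D (pred1 d).
  apply/centzP; split=> // _ /eqP->; apply/eqP; rewrite -subr_eq0; apply/eqP.
  apply: (ymin (fun i => y i * d - d * y i)) => [|j ->|]; last first.
  - by rewrite y1 mul1r mulr1 subrr.
  - by rewrite mul0r mulr0 subrr.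
  split=> [j|j].
    by rewrite (divringD Dcl) ?(divringN Dcl) ?(divringM Dcl).
  have E k : (y k * d - d * y k) * (d ^+ j * v k) =
      y k * (d ^+ j.+1 * v k) - d * (y k * (d ^+ j * v k)).
    by rewrite mulrBl exprS !mulrA.
  under eq_bigr => k _ do rewrite E.
  rewrite sumrB -mulr_sumr yv mulr0 subr0.
  have [ltj|] := ltnP j.+1 e; first exact: (yv (Ordinal ltj)).
  by move=> lej; have -> : j.+1 = e by apply/eqP; rewrite eqn_leq lej ltn_ord.
have /(fv y yM)/(_ i0)/eqP : \sum_i y i * v i = 0.
  by rewrite -[RHS](yv (Ordinal e0)); apply: eq_bigr => i _; rewrite expr0 mul1r.
by rewrite y1 oner_eq0.
Qed.

End Subalgebras.

(** * Simple extensions *)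

Section SimpleExtensions.
Variables (K : fieldType) (Q : unitAlgType K).
Hypothesis Qdiv : forall x : Q, x != 0 -> x \is a GRing.unit.

Lemma horner_algE (x : Q) (p : {poly K}) n :
  (size p <= n)%N -> horner_alg x p = \sum_(i < n) p`_i *: x ^+ i.
Proof.
move=> sp; have {1}-> : p = \sum_(i < n) p`_i *: 'X^i.
  by rewrite -poly_def; apply/polyP => i; rewrite coef_poly; case: ltnP => // /(leq_trans sp)/(nth_default 0)->.
rewrite linear_sum; apply: eq_bigr => i _.
by rewrite linearZ rmorphXn /= horner_algX mulr_algl.
Qed.

Lemma horner_alg_in (D : {pred Q}) x p :
  divalg_closed D -> x \in D -> horner_alg x p \in D.
Proof.
move=> Dcl Dx; rewrite (@horner_algE x p (size p)) //.
by apply: (divring_sum Dcl) => i _; apply: divalgZ => //; apply: divalgX.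
Qed.

Lemma horner_alg_comm (x y : Q) p : x * y = y * x -> horner_alg x p * y = y * horner_alg x p.
Proof.
move=> xy; rewrite (@horner_algE x p (size p)) // mulr_suml mulr_sumr.
apply: eq_bigr => i _; rewrite -scalerAl -scalerAr.
by rewrite (commrX i (esym xy : GRing.comm y x)).
Qed.

Definition transc (x : Q) : Prop := forall p : {poly K}, horner_alg x p = 0 -> p = 0.

Lemma transc_neq0 x p : transc x -> p != 0 -> horner_alg x p != 0.
Proof. by move=> tx; apply: contra_neq => /tx. Qed.

Definition adjoin (x : Q) : {pred Q} := fun y =>
  `[< exists p q : {poly K}, q != 0 /\ y = horner_alg x p / horner_alg x q >].

Lemma adjoinP x y : reflect
  (exists p q : {poly K}, q != 0 /\ y = horner_alg x p / horner_alg x q) (y \in adjoin x).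
Proof. exact: asboolP. Qed.

Lemma adjoin_horner x p : horner_alg x p \in adjoin x.
Proof. by apply/adjoinP; exists p, 1; rewrite oner_eq0 rmorph1 divr1. Qed.

Lemma adjoin_gen x : x \in adjoin x.
Proof. by rewrite -{1}(horner_algX x) adjoin_horner. Qed.

Lemma adjoin_sub (D : {pred Q}) x y :
  divalg_closed D -> x \in D -> y \in adjoin x -> y \in D.
Proof.
move=> Dcl Dx /adjoinP[p [q [_ ->]]].
by case: (Dcl) => _ _; apply; apply: horner_alg_in.
Qed.

Lemma horner_algC2 (x : Q) p q : horner_alg x p * horner_alg x q = horner_alg x q * horner_alg x p.
Proof. by rewrite -!rmorphM mulrC. Qed.

Section Transcendental.
Variable x : Q.
Hypothesis tx : transc x.

Let hu q : q != 0 -> horner_alg x q \is a GRing.unit.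
Proof. by move=> q0; apply/Qdiv/transc_neq0. Qed.

Lemma adjoin_divE p q r : r != 0 -> q != 0 ->
  horner_alg x p / horner_alg x q = horner_alg x (p * r) / horner_alg x (q * r).
Proof.
by move=> r0 q0; rewrite !rmorphM /= invrM ?hu // mulrA mulrK ?hu.
Qed.

Lemma adjoin_divalg : divalg_closed (adjoin x).
Proof.
apply: divalg_closedP => [|k y|y z|y z|y].
- by rewrite -(rmorph1 (horner_alg x)) adjoin_horner.
- move=> /adjoinP[p [q [q0 ->]]]; apply/adjoinP; exists (k *: p), q; split=> //.
  by rewrite linearZ /= mulr_algl scalerAl.
- move=> /adjoinP[p [q [q0 ->]]] /adjoinP[p' [q' [q0' ->]]].
  apply/adjoinP; exists (p * q' + p' * q), (q * q'); split; first exact: mulf_neq0.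
  rewrite (adjoin_divE p q0' q0) (adjoin_divE p' q0 q0') (mulrC q' q).
  by rewrite -mulrDl -rmorphD.
- move=> /adjoinP[p [q [q0 ->]]] /adjoinP[p' [q' [q0' ->]]].
  apply/adjoinP; exists (p * p'), (q * q'); split; first exact: mulf_neq0.
  have c1 := commV (horner_algC2 x q p').
  have c2 : (horner_alg x q)^-1 * (horner_alg x q')^-1 =
      (horner_alg x q')^-1 * (horner_alg x q)^-1.
    exact/commV/esym/commV/horner_algC2.
  rewrite !rmorphM /= invrM ?hu // -!mulrA; congr (_ * _).
  by rewrite mulrA c1 -mulrA c2.
move=> /adjoinP[p [q [q0 ->]]] e0; apply/adjoinP; exists q, p.
have p0 : p != 0 by apply: contraNneq e0 => ->; rewrite rmorph0 mul0r.
by split=> //; rewrite invrM ?unitrV ?hu // invrK -(commV (horner_algC2 x p q)) commV // horner_algC2.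
Qed.

Lemma adjoin_common_den (I : finType) (c : I -> Q) :
  (forall i, c i \in adjoin x) ->
  exists2 q : {poly K}, q != 0 &
    exists p : I -> {poly K}, forall i, c i = (horner_alg x q)^-1 * horner_alg x (p i).
Proof.
move=> cE; have /choice[pq pqP] : forall i, exists pq : {poly K} * {poly K},
    pq.2 != 0 /\ c i = horner_alg x pq.1 / horner_alg x pq.2.
  by move=> i; case/adjoinP: (cE i) => p [q]; exists (p, q).
exists (\prod_i (pq i).2).
  by rewrite prodf_seq_neq0; apply/allP => i _; rewrite (pqP i).1.
exists (fun i => (pq i).1 * \prod_(j | j != i) (pq j).2) => i.
rewrite (pqP i).2; have q0 : \prod_(j | j != i) (pq j).2 != 0.
  by apply/prodf_neq0 => j _; rewrite (pqP j).1.
rewrite (adjoin_divE _ q0) ?(pqP i).1 // [in RHS](bigD1 i) //=.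
by rewrite commV // horner_algC2.
Qed.

Lemma adjoin_comm y :
  x * y = y * x -> forall z, z \in adjoin x -> z * y = y * z.
Proof.
move=> xy z /adjoinP[p [q [q0 ->]]]; rewrite -mulrA (commV (horner_alg_comm q xy)).
by rewrite mulrA (horner_alg_comm p xy) mulrA.
Qed.

Lemma adjoin_commutative : commutative_set (adjoin x).
Proof.
move=> y z Ey Ez; apply: adjoin_comm => //.
by apply/esym/adjoin_comm.
Qed.

(** Coefficients in K(x) have a common denominator, so freeness need only be tested on polynomial
    coefficients. *)
Lemma frl_adjoin (I : finType) (v : I -> Q) :
  (forall p : I -> {poly K}, \sum_i horner_alg x (p i) * v i = 0 -> forall i, p i = 0) ->
  frl (adjoin x) v.
Proof.
move=> fv c cE e0 i; have [q q0 [p pE]] := adjoin_common_den cE.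
rewrite pE (fv p) ?rmorph0 ?mulr0 // -[RHS](mulr0 (horner_alg x q)) -[in RHS]e0 mulr_sumr.
by apply: eq_bigr => j _; rewrite pE !mulrA mulrV ?mul1r ?hu.
Qed.

End Transcendental.

Lemma frl_powers (x : Q) n : transc x ->
  frl (@kscal K Q) (fun i : 'I_n => x ^+ i).
Proof.
move=> tx c cK; have /choice[k kE] : forall i, exists k : K, c i = k%:A.
  by move=> i; apply/kscalP.
move=> e0 i; suff : \poly_(i < n) (if insub i is Some j then k j else 0) = 0.
  move=> /polyP/(_ i); rewrite coef_poly ltn_ord coef0 valK kE => ->.
  by rewrite scale0r.
apply: tx; rewrite (@horner_algE x _ n) ?size_poly //.
rewrite -[RHS]e0; apply: eq_bigr => j _.
by rewrite coef_poly ltn_ord valK kE mulr_algl.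
Qed.

End SimpleExtensions.

(** * Over an algebraically closed field: scalar or transcendental *)

Section ClosedField.
Variables (K : closedFieldType) (Q : unitAlgType K).
Hypothesis Qdiv : forall x : Q, x != 0 -> x \is a GRing.unit.

(** The polynomial splits into linear factors, and in a division algebra one of their values must
    vanish. *)
Lemma algebraic_kscal (x : Q) (p : {poly K}) :
  p != 0 -> horner_alg x p = 0 -> x \in @kscal K Q.
Proof.
move=> p0; have [r ->] := closed_field_poly_normal p.
rewrite linearZ /= rmorph_prod /= => /(divr_eq0 Qdiv)[/eqP|].
  by rewrite scaler_eq0 lead_coef_eq0 (negbTE p0) oner_eq0.
elim: r => [|a r IH]; first by rewrite big_nil => /eqP; rewrite oner_eq0.
rewrite big_cons => /(divr_eq0 Qdiv)[|/IH//].
rewrite rmorphB /= horner_algX horner_algC => /eqP; rewrite subr_eq0 => /eqP->.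
by apply/kscalP; exists a.
Qed.

Lemma transc_notin (x : Q) : ~ transc x -> x \in @kscal K Q.
Proof.
by move=> /existsNP[p /not_implyP[p0 /eqP pn0]]; apply: algebraic_kscal pn0 p0.
Qed.

Lemma noncomm_transc (x y : Q) : x * y != y * x -> transc x.
Proof.
move=> xy; apply: contrapT => /transc_notin/kscalP[k xk].
by case/eqP: xy; rewrite xk mulr_algl mulr_algr.
Qed.

End ClosedField.

(** * The filtration and its growth *)

Section Filtration.
Variables (K : fieldType) (Q : unitAlgType K).
Hypothesis Qdiv : forall x : Q, x != 0 -> x \is a GRing.unit.

Local Notation kQ := (@kscal K Q).
Let kcl : GRing.divring_closed kQ := kscal_divalg Q.

Lemma kscal_choice (I : finType) (c : I -> Q) :
  (forall i, c i \in kQ) -> exists k : I -> K, forall i, c i = (k i)%:A.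
Proof.
move=> cK; have /choice[k kE] : forall i, exists k : K, c i = k%:A by move=> i; apply/kscalP.
by exists k.
Qed.

Lemma in_spanP (vs : seq Q) x :
  in_span vs x <-> spn kQ (fun i : 'I_(size vs) => vs`_i) x.
Proof.
split=> [[c ->]|[c [/kscal_choice[k kE] ->]]].
  exists (fun i : 'I_(size vs) => (c`_i)%:A); split=> [i|]; first by apply/kscalP; exists c`_i.
  by apply: eq_bigr => i _; rewrite mulr_algl.
exists (mkseq (fun i => if insub i is Some j then k j else 0) (size vs)).
by apply: eq_bigr => i _; rewrite nth_mkseq // valK kE mulr_algl.
Qed.

Lemma lin_freeP (vs : seq Q) :
  lin_free vs <-> frl kQ (fun i : 'I_(size vs) => vs`_i).
Proof.
split=> [fv c /kscal_choice[k kE] e0 i|fv c e0 i lti].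
  have := fv (mkseq (fun i => if insub i is Some j then k j else 0) (size vs)) _ i (ltn_ord i).
  rewrite nth_mkseq // valK kE => ->; rewrite ?scale0r // -[RHS]e0.
  by apply: eq_bigr => j _; rewrite nth_mkseq // valK kE mulr_algl.
have /(_ (Ordinal lti))/eqP : forall j : 'I_(size vs), (c`_j)%:A = 0 :> Q.
  apply: fv => [j|]; first by apply/kscalP; exists c`_j.
  by rewrite -[RHS]e0; apply: eq_bigr => j _; rewrite mulr_algl.
by rewrite scaler_eq0 oner_eq0 orbF => /eqP.
Qed.

Lemma in_span_lspace (vs : seq Q) : lspace kQ (in_span vs).
Proof.
have [P0 PD PZ] := spn_lspace kcl (fun i : 'I_(size vs) => vs`_i).
split=> [|x y /in_spanP vx /in_spanP vy|c x cK /in_spanP vx]; apply/in_spanP => //.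
  exact: PD.
exact: PZ.
Qed.

Lemma in_span_mem (vs : seq Q) x : x \in vs -> in_span vs x.
Proof.
by move=> /(nthP 0)[i lti <-]; apply/in_spanP; apply: (spn_gen kcl _ (Ordinal lti)).
Qed.

Lemma in_span_sub (X : Q -> Prop) (vs : seq Q) x :
  lspace kQ X -> (forall v, v \in vs -> X v) -> in_span vs x -> X x.
Proof.
by move=> lX Xv /in_spanP; apply: spn_sub => // i; apply/Xv/mem_nth.
Qed.

Lemma lin_free_cons (vs : seq Q) x :
  lin_free vs -> ~ in_span vs x -> lin_free (x :: vs).
Proof.
move=> fv nx c; rewrite /= big_ord_recl /= => e0.
have c0 : c`_0 = 0.
  apply: contrapT => /eqP c0; apply: nx.
  exists (mkseq (fun i => - (c`_0)^-1 * c`_i.+1) (size vs)).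
  have -> : x = - (c`_0)^-1 *: \sum_(i < size vs) c`_i.+1 *: vs`_i.
    move/eqP: e0; rewrite addr_eq0 => /eqP e0.
    by rewrite scaleNr -scalerN -e0 scalerA mulVf // scale1r.
  by rewrite scaler_sumr; apply: eq_bigr => i _; rewrite scalerA nth_mkseq.
move: e0; rewrite c0 scale0r add0r => e0 [|i] lti //.
rewrite -nth_behead; apply: fv => //.
by rewrite -[RHS]e0; apply: eq_bigr => j _; rewrite nth_behead.
Qed.

Lemma free_mask (vs : seq Q) : exists m : (size vs).-tuple bool,
  lin_free (mask m vs) /\ forall v, v \in vs -> in_span (mask m vs) v.
Proof.
elim: vs => [|x vs [m [fm sm]]]; first by exists [tuple]; split=> // c _ i.
have [xm|nx] := EM (in_span (mask m vs) x).
  exists [tuple of false :: m]; split=> // v; rewrite inE => /predU1P[->//|].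
  exact: sm.
exists [tuple of true :: m]; split; first exact: lin_free_cons.
move=> v; rewrite inE => /predU1P[->|/sm]; first by apply: in_span_mem; rewrite inE eqxx.
by apply: in_span_sub; [apply: in_span_lspace|move=> w wm; apply: in_span_mem; rewrite /= inE wm orbT].
Qed.

(** The free sublist given by [free_mask] spans, so the maximum in [span_dim] is the dimension of
    the span. *)
Lemma span_dim_fdim (vs : seq Q) : fdim kQ (in_span vs) (span_dim vs).
Proof.
have [m [/[dup] fm /lin_freeP fm' sm]] := free_mask vs.
suff -> : span_dim vs = size (mask m vs).
  exists (fun i => (mask m vs)`_i); split=> //.
    move=> i; apply: (in_span_sub (in_span_lspace _) (vs := mask m vs)).
      by move=> v /mem_mask; apply: in_span_mem.
    exact/in_span_mem/mem_nth.
  by move=> x /(in_span_sub (in_span_lspace _) sm)/in_spanP.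
apply/eqP; rewrite eqn_leq; apply/andP; split; last first.
  by apply: (leq_bigmax_cond (F := fun m => size (mask _ _))); apply/asboolP.
apply/bigmax_leqP => m' /asboolP/lin_freeP fm1.
rewrite -[size _]card_ord -[size (mask m vs)]card_ord.
apply: (frl_le_spn Qdiv kcl fm1) => i; apply/in_spanP.
by apply/(in_span_sub (in_span_lspace _) sm)/in_span_mem/mem_mask/mem_nth.
Qed.

Variable s : seq Q.
Local Notation V := (fun n => in_span (words s n)).
Local Notation d := (fun n => span_dim (words s n)).

Lemma words_mul n m x y :
  x \in words s n -> y \in words s m -> x * y \in words s (n + m).
Proof.
have wS k : words s k.+1 = [seq a * b | a <- 1 :: s, b <- words s k] by [].
have wM k a b : a \in 1 :: s -> b \in words s k -> a * b \in words s k.+1.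
  by move=> as_ bk; rewrite wS; apply/allpairsP; exists (a, b).
elim: n x => [|n IH] x; first by rewrite inE => /eqP->; rewrite mul1r.
rewrite wS addSn => /allpairsP[[a b] /= [as_ bn ->]] ym.
by rewrite -mulrA; apply: wM => //; apply: IH.
Qed.

Lemma filt_mul n m x y : V n x -> V m y -> V (n + m)%N (x * y).
Proof.
move=> Vx Vy; have [V0 VD VZ] := in_span_lspace (words s (n + m)).
apply: (in_span_sub (X := fun x => V (n + m)%N (x * y))) Vx => [|x' x'n].
  split=> [|a b|c a cK]; first by rewrite mul0r.
    by rewrite mulrDl; apply: VD.
  by rewrite -mulrA; apply: VZ.
apply: (in_span_sub (X := fun y => V (n + m)%N (x' * y))) Vy => [|y' y'm].
  split=> [|a b|c a /kscalP[k ->]]; first by rewrite mulr0.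
    by rewrite mulrDr; apply: VD.
  by rewrite mulrA mulr_algr -mulr_algl -mulrA; apply: VZ; apply/kscalP; exists k.
exact/in_span_mem/words_mul.
Qed.

Lemma filt1 n : V n 1.
Proof.
elim: n => [|n IH]; first by apply: in_span_mem; rewrite inE.
rewrite -[1]mul1r -[n.+1]addn1; apply: filt_mul => //; apply: in_span_mem.
by rewrite /= mulr1 inE eqxx.
Qed.

Lemma filt_le n m x : (n <= m)%N -> V n x -> V m x.
Proof.
by move=> /subnKC <- Vx; rewrite -[x]mulr1; apply: filt_mul => //; apply: filt1.
Qed.

Lemma filt_dim n : fdim kQ (V n) (d n).
Proof. exact: span_dim_fdim. Qed.

Lemma filt_dim_gt0 n : (0 < d n)%N.
Proof.
rewrite -[X in (X <= _)%N](card_ord 1).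
apply: (fdim_le Qdiv kcl (filt_dim n) (v := fun=> 1)) => [_|c _]; first exact: filt1.
by rewrite big_ord1 mulr1 => c0 i; rewrite ord1.
Qed.

Lemma filt_dim_le n m : (n <= m)%N -> (d n <= d m)%N.
Proof.
move=> lenm; have [v [Vv fv _]] := filt_dim n.
rewrite -[d n]card_ord; apply: (fdim_le Qdiv kcl (filt_dim m) _ fv) => i.
exact: filt_le (Vv i).
Qed.

End Filtration.

Section LinearSystems.
Variable R : unitRingType.
Hypothesis Rdiv : forall x : R, x != 0 -> x \is a GRing.unit.
Variable S : {pred R}.
Hypothesis Scl : GRing.divring_closed S.

(** In a basis of [X], each of the equations indexed by [J] becomes [e] scalar equations for the
    unknowns [k]. *)
Lemma lin_sys (X : R -> Prop) e (I J : finType) (w : I -> J -> R) :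
  fdim S X e -> (forall i j, X (w i j)) -> (#|J| * e < #|I|)%N ->
  exists k : I -> R, [/\ forall i, k i \in S, exists i, k i != 0
    & forall j, \sum_i k i * w i j = 0].
Proof.
move=> [u [_ _ us]] Xw ltI.
have /choice[A AP] : forall i, exists A : J -> 'I_e -> R, forall j,
    (forall t, A j t \in S) /\ w i j = \sum_t A j t * u t.
  move=> i; have /choice[A AP] : forall j, spn S u (w i j) by move=> j; apply: us.
  by exists A.
have [||k [kS k0 kA]] := left_kernel Scl (fun x _ => @Rdiv x)
    (A := fun i (p : J * 'I_e) => A i p.1 p.2).
- by move=> i [j t]; case: (AP i j).
- by rewrite card_prod card_ord.
exists k; split=> // j; under eq_bigr => i _.
  rewrite (AP i j).2 mulr_sumr; under eq_bigr => t _ do rewrite mulrA; over.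
by rewrite exchange_big big1 // => t _; rewrite -mulr_suml (kA (j, t)) mul0r.
Qed.

Lemma left_findim_spn (I : finType) (w : I -> R) :
  (forall q, spn S w q) ->
  exists b : seq R, forall q : R, exists c : seq R,
    all (mem S) c /\ q = \sum_(i < size b) c`_i * b`_i.
Proof.
move=> ws; pose v (i : 'I_#|I|) := w (enum_val i).
pose f (T : nmodType) (g : 'I_#|I| -> T) := mkseq (fun i => if insub i is Some j then g j else 0) #|I|.
have fE T g (i : 'I_#|I|) : (f T g)`_i = g i by rewrite nth_mkseq // valK.
exists (f R v) => q.
have [c [cS qE]] := spn_reindex (enum_val_bijective I) (ws q).
exists (f R c); split.
  apply/(all_nthP 0) => i; rewrite size_mkseq => lti.
  by rewrite (fE R c (Ordinal lti)); apply: cS.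
rewrite qE size_mkseq; apply: eq_bigr => i _; by rewrite !fE.
Qed.

End LinearSystems.

(** * Denominators, and lower bounds for the growth of the filtration *)

Section Denominators.
Variables (K : fieldType) (Q : unitAlgType K) (s : seq Q).
Hypothesis Qdiv : forall x : Q, x != 0 -> x \is a GRing.unit.
Local Notation V := (fun n => in_span (words s n)).
Local Notation d := (fun n => span_dim (words s n)).
Local Notation kQ := (@kscal K Q).
Let kcl : GRing.divring_closed kQ := kscal_divalg Q.
Let VE n := in_span_lspace (words s n).

Let VB n x y : V n x -> V n y -> V n (x - y).
Proof.
case: (VE n) => _ VD VZ Vx Vy; apply: VD => //; rewrite -mulN1r; apply: VZ => //.
by rewrite (divringN kcl) ?(divring1 kcl).
Qed.

Let VN n x : V n x -> V n (- x).
Proof. by move=> Vx; rewrite -sub0r; apply: VB => //; case: (VE n). Qed.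

Hypothesis slow : forall c N, exists2 m, (N <= m)%N & (m * (d (m + c) - d m) <= 15 * c * d m)%N.
Hypothesis QA : is_quotient_ring (gen_alg s).

(** An Ore condition from slow growth: for q = a1 / b1 with a1, b1 in V^p, the spaces V^n a1 and V^n
    b1 cannot be independent inside V^(n + p) once d(n + p) < 2 d(n). A relation al a1 + be b1 = 0
    gives al q = - be. *)
Lemma left_denominator q : exists b c, [/\ b != 0, V c b & V c (b * q)].
Proof.
have [a1 [b1 [/asboolP[p1 Va1] /asboolP[p2 Vb1] b10 qE]]] := QA q.
pose p := (p1 + p2)%N.
have {}Va1 : V p a1 by apply: filt_le Va1; apply: leq_addr.
have {}Vb1 : V p b1 by apply: filt_le Vb1; apply: leq_addl.
have [n lt2] : exists n, (d (n + p) < d n + d n)%N.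
  (* For n > 15 p, the bound n (d(n + p) - d(n)) <= 15 p d(n) makes the increment smaller than
     d(n). *)
  have [n len le] := slow p (15 * p).+1.
  by exists n; have := filt_dim_gt0 Qdiv s n; have := filt_dim_le Qdiv s (leq_addr p n); nia.
have [v [Vv fv _]] := filt_dim Qdiv s n.
apply: contrapT => H; move: lt2; rewrite ltnNge => /negP; apply.
pose w (i : 'I_(d n) + 'I_(d n)) := match i with inl i => v i * a1 | inr i => v i * b1 end.
have <- : #|{: 'I_(d n) + 'I_(d n)}| = (d n + d n)%N by rewrite card_sum !card_ord.
apply: (fdim_le Qdiv kcl (filt_dim Qdiv s (n + p)) (v := w)) => [[i|i]|c cK].
- exact: filt_mul.
- exact: filt_mul.
rewrite big_sumType /=.
set al := \sum_i c (inl i) * v i; set be := \sum_i c (inr i) * v i.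
have -> : \sum_i c (inl i) * (v i * a1) = al * a1.
  by rewrite mulr_suml; apply: eq_bigr => i _; rewrite mulrA.
have -> : \sum_i c (inr i) * (v i * b1) = be * b1.
  by rewrite mulr_suml; apply: eq_bigr => i _; rewrite mulrA.
move=> e0.
have Vsum (g : 'I_(d n) -> Q) : (forall i, g i \in kQ) -> V n (\sum_i g i * v i).
  by move=> gK; apply: lspace_sum (VE n) gK _.
have al0 : al = 0.
  apply: contrapT => /eqP al0; apply: H; exists al, n; split=> //; first exact: Vsum.
  rewrite qE mulrA; move/eqP: e0; rewrite addr_eq0 => /eqP->.
  by rewrite -mulNr mulrK ?Qdiv //; apply/VN/Vsum.
move: e0; rewrite al0 mul0r add0r => /(divr_eq0 Qdiv)[be0|/eqP]; last by rewrite (negbTE b10).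
by case=> i; [apply: (fv (fun i => c (inl i)))|apply: (fv (fun i => c (inr i)))].
Qed.

Lemma common_left_denominator (qs : seq Q) :
  exists b c, [/\ b != 0, V c b & forall q, q \in qs -> V c (b * q)].
Proof.
elim: qs => [|q qs [b [c [b0 Vb Vq]]]].
  by exists 1, 0%N; split=> //; [apply: oner_neq0|apply: filt1].
have [b2 [c2 [b20 Vb2 Vb2q]]] := left_denominator (b * q).
exists (b2 * b), (c2 + c)%N; split; first exact: divr_neq0.
  exact: filt_mul.
move=> q'; rewrite inE -mulrA => /predU1P[->|/Vq Vq'].
  by apply: filt_le Vb2q; apply: leq_addr.
exact: filt_mul.
Qed.

(** The spaces [X i] = D z V^i keep growing. If [X i] contained z V^(i + 1), it would be stable
    under right multiplication by every V^n and, being finite dimensional, under division by their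
    nonzero elements. It would then contain z (a / b) for every fraction, that is, all of [Q]. So
    [u] can be chosen with z u_(i + 1) outside [X i]. *)
Lemma filt_rank_growth (D : {pred Q}) z :
  divalg_closed D -> ~ left_findim D -> z != 0 ->
  exists u : nat -> Q, (forall i, V i (u i)) /\
    forall n, frl D (fun j : 'I_n => z * u j).
Proof.
move=> Dcl nfD z0.
pose X i := spn D (fun k : 'I_(size (words s i)) => z * (words s i)`_k).
have XL i : lspace D (X i) by exact: (spn_lspace Dcl).
have Xz i a : V i a -> X i (z * a).
  apply: (in_span_sub (X := fun a => X i (z * a))).
    case: (XL i) => X0 XD XZ; split=> [|a1 a2|k a1 /kscalP[k' ->]]; first by rewrite mulr0.
      by rewrite mulrDr; apply: XD.
    by rewrite mulr_algl -scalerAr -mulr_algl; apply: XZ; apply: divalgA.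
  move=> w /(nthP 0)[k ltk <-].
  exact: (spn_gen Dcl (fun k : 'I_(size (words s i)) => z * (words s i)`_k) (Ordinal ltk)).
have ex i : exists w, V i.+1 w /\ ~ X i (z * w).
  apply: contrapT => H; apply: nfD.
  have Xw w : V i.+1 w -> X i (z * w).
    by move=> Vw; apply: contrapT => nX; apply: H; exists w.
  have X1 x a : V 1 a -> X i x -> X i (x * a).
    move=> Va; apply: (spn_sub (X := fun x => X i (x * a))).
      case: (XL i) => X0 XD XZ; split=> [|a1 a2|k a1 kD]; first by rewrite mul0r.
        by rewrite mulrDl; apply: XD.
      by rewrite -mulrA; apply: XZ.
    move=> k; rewrite -mulrA; apply: Xw; rewrite -addn1; apply: filt_mul => //.
    exact/in_span_mem/mem_nth.
  have Xn n a : V n a -> forall x, X i x -> X i (x * a).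
    elim: n a => [|n IH] a.
      move=> [c ->] x Xx; rewrite big_ord1 /= -scalerAr mulr1 -mulr_algl.
      by case: (XL i) => _ _; apply=> //; apply: divalgA.
    apply: (in_span_sub (X := fun a => forall x, X i x -> X i (x * a))).
      case: (XL i) => X0 XD XZ; split=> [x|a1 a2 h1 h2 x Xx|k a1 /kscalP[k' ->] h x Xx].
      - by rewrite mulr0.
      - by rewrite mulrDr; apply: XD; [apply: h1|apply: h2].
      - by rewrite mulr_algl -scalerAr -mulr_algl; apply: XZ; [apply: divalgA|apply: h].
    move=> w; have -> : words s n.+1 = [seq x * y | x <- 1 :: s, y <- words s n] by [].
    move=> /allpairsP[[a1 a2] /= [a1s a2n ->]] x Xx; rewrite mulrA.
    apply: IH; first exact: in_span_mem.
    apply: X1 => //; rewrite -[a1]mulr1; apply: in_span_mem.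
    have -> : words s 1 = [seq x * y | x <- 1 :: s, y <- [:: 1]] by [].
    by apply/allpairsP; exists (a1, 1); split=> //; rewrite inE.
  apply: (left_findim_spn (S := D) (w := fun k : 'I_(size (words s i)) => z * (words s i)`_k)) => q.
  have [n _ dX] := fdim_spanned Qdiv Dcl (fun x (Xx : X i x) => Xx).
  have [a [b [/asboolP[na Va] /asboolP[nb Vb] b0 qE]]] := QA (z^-1 * q).
  rewrite -/(X i q) -[q](mulVKr (Qdiv z0) q) qE mulrA.
  apply: (fdim_mulr_onto Qdiv Dcl (XL i) dX b0); first exact: Xn Vb.
  apply: (Xn _ _ Va); rewrite -[z]mulr1; apply: Xz; exact: filt1.
have [u uP] := choice ex.
exists (fun i => if i is j.+1 then u j else 1); split=> [[|i]|n].
- exact: filt1.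
- by case: (uP i).
apply: (frl_extend_all Qdiv Dcl (v := fun j => z * (if j is k.+1 then u k else 1))) => -[|i] _.
  by case=> c [_ /eqP]; rewrite big_ord0 mulr1 (negbTE z0).
move=> H; have [_] := uP i; apply; apply: spn_sub H => // -[[|j] ltj] /=.
  by apply: Xz; apply: filt1.
by apply: Xz; apply: filt_le (uP j).1.
Qed.

Section Rank.
Variable x : Q.
Hypothesis tx : transc x.

(* Were the increment smaller, a Horner scheme for [\sum_(l, a) k_(l, a) x ^ a t_l]
   with intermediate values in [V N] would have a nontrivial solution. *)
Lemma adjoin_rank_growth b c N r (t : 'I_r -> Q) :
  b != 0 -> V c b -> V c (b * x) -> (forall l, V N (t l)) ->
  frl (adjoin x) t -> (d N + r <= d (c + N))%N.
Proof.
move=> b0 Vb Vbx Vt ft; rewrite leqNgt; apply/negP => lt.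
have [v [Vv fv _]] := filt_dim Qdiv s N.
set n := d N in lt v Vv fv.
have x0 : x != 0.
  by apply/eqP => xE; have := @tx 'X; rewrite horner_algX => /(_ xE)/eqP; rewrite polyX_eq0.
(* With y_a = sum_k k_(k, a) v_k and y_(-1) = y_n = 0, equation a reads b y_(a - 1) = b x y_a + b
   sum_l k_(l, a) t_l. *)
pose w (i : ('I_r * 'I_n.+1) + ('I_n * 'I_n)) (a : 'I_n.+1) : Q :=
  match i with
  | inl (l, a') => (a == a')%:R * (b * t l)
  | inr (k, a') => (a == a' :> nat)%:R * (b * x * v k) - (a == a'.+1 :> nat)%:R * (b * v k)
  end.
have Vb2 (B : bool) y : V (c + N)%N y -> V (c + N)%N (B%:R * y).
  by case: B; rewrite ?mul1r // mul0r => _; case: (VE (c + N)%N).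
have [i a||k [kK [i ki] kw]] := lin_sys Qdiv kcl (w := w) (filt_dim Qdiv s (c + N)%N).
- by case: i => [[l a']|[k a']] /=; [|apply: VB]; apply: Vb2; apply: filt_mul.
(* The count succeeds by one: r (n + 1) + n^2 unknowns against at most (n + 1) (n + r - 1) scalar
   equations. *)
- rewrite card_sum !card_prod !card_ord.
  by move: lt; rewrite -/n; move: (d _) => e; nia.
(* Multiplying equation a by x^a b^-1 on the left and summing over a telescopes the intermediate
   values away. *)
have h1 : \sum_(l < r) (\sum_(a < n.+1) k (inl (l, a)) * x ^+ a) * t l = 0.
  have : \sum_(a < n.+1) x ^+ a * (b^-1 * \sum_i k i * w i a) = 0.
    by rewrite big1 // => a _; rewrite kw !mulr0.
  under eq_bigr => a _.
    rewrite 2!mulr_sumr; under eq_bigr => j _.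
      have /kscalP[kj kjE] := kK j.
      have -> : x ^+ a * (b^-1 * (k j * w j a)) = k j * (x ^+ a * (b^-1 * w j a)).
        by rewrite kjE !mulr_algl -!scalerAr.
      over.
    over.
  rewrite exchange_big big_sumType /= [X in _ + X]big1 ?addr0.
    rewrite sum_pairE => e0; rewrite -[RHS]e0.
    apply: eq_bigr => l _; rewrite mulr_suml; apply: eq_bigr => a _.
    rewrite -mulr_sumr (bigD1 a) //= eqxx mul1r mulKr ?Qdiv // big1 ?addr0 ?mulrA //.
    by move=> a' /negbTE->; rewrite mul0r !mulr0.
  move=> [l a] _; rewrite -mulr_sumr.
  rewrite (bigD1 (widen_ord (leqnSn n) a)) //= (bigD1 (lift ord0 a)) //=; last first.
    by rewrite -val_eqE /= /bump /= add1n; lia.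
  rewrite big1.
    have e1 : (a == a.+1 :> nat) = false by lia.
    have e2 : (a.+1 == a :> nat) = false by lia.
    rewrite /bump /= add1n !eqxx e1 e2 !mul0r !mul1r sub0r subr0 addr0.
    rewrite -!mulrA mulKr ?Qdiv // mulrN mulKr ?Qdiv //.
    by rewrite mulrN exprSr -mulrA subrr mulr0.
  move=> a' /andP[]; rewrite -!val_eqE /= /bump /= add1n => /negbTE-> /negbTE->.
  by rewrite !mul0r subrr !mulr0.
have kl (l : 'I_r) (a : 'I_n.+1) : k (inl (l, a)) = 0.
  apply: (@frl_powers K Q x n.+1 tx (fun a => k (inl (l, a)))) => [a'|]; first exact: kK.
  apply: (ft (fun l => \sum_(a < n.+1) k (inl (l, a)) * x ^+ a)) => // l'.
  have Ecl := adjoin_divalg Qdiv tx.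
  apply: (divring_sum Ecl) => a' _; apply: (divringM Ecl).
    by have /kscalP[k' ->] := kK (inl (l', a')); apply: divalgA.
  by apply: divalgX => //; apply: adjoin_gen.
(* Only intermediate values can be nonzero now. For the largest index a0 with a nonzero coefficient,
   equation a0 + 1 reduces to b y_(a0) = 0. *)
case: i ki => [[l a]|p0 kp0]; first by rewrite kl eqxx.
case: (arg_maxnP (fun p : 'I_n * 'I_n => p.2 : nat) (P := fun p => k (inr p) != 0) kp0).
move=> [l0 a0] /= kla maxa; have := kw (lift ord0 a0).
rewrite big_sumType /= big1 ?add0r => [|[l a] _]; last by rewrite kl mul0r.
rewrite sum_pairE => h.
suff /(fv (fun l => k (inr (l, a0)))) h0 : \sum_(l < n) k (inr (l, a0)) * v l = 0.
  by rewrite h0 ?eqxx in kla => // l.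
have : b * \sum_(l < n) k (inr (l, a0)) * v l = 0.
  rewrite -[RHS]oppr0 -[in RHS]h -sumrN mulr_sumr; apply: eq_bigr => l _.
  rewrite (bigD1 a0) //= big1 ?addr0.
    rewrite /bump /= add1n eqxx eqn_leq ltnn /= mul0r mul1r sub0r mulrN opprK.
    by have /kscalP[k' ->] := kK (inr (l, a0)); rewrite !mulr_algl -scalerAr.
  move=> a; rewrite -val_eqE /bump /= add1n => aa0.
  have [lea|lta] := leqP a a0; last first.
    suff -> : k (inr (l, a)) = 0 by rewrite mul0r.
    apply: contrapT => /eqP/maxa /=; by rewrite leqNgt lta.
  have -> : (a0.+1 == a :> nat) = false by lia.
  have -> : (a0.+1 == a.+1 :> nat) = false by lia.
  by rewrite !mul0r subrr mulr0.
by case/(divr_eq0 Qdiv) => // /eqP; rewrite (negbTE b0).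
Qed.

End Rank.
End Denominators.

(** * Growth of suffix-closed trees *)

(* [t 0, ..., t (N - 1)] enumerates words in the letters [W], closed under taking suffixes. *)
Definition suffix_tree (Q : nzRingType) (W : seq Q) (N : nat) (t : nat -> Q) : Prop :=
  t 0%N = 1 /\ forall j, (j.+1 < N)%N ->
    exists w i, [/\ w \in W, (i <= j)%N & t j.+1 = w * t i].

(** The bound 2 r leaves room for words present only as suffixes: in [free_powers_tree] the x^i are
    listed for the sake of the free words b x^i. *)
Definition tree_rank_ge (Q : unitRingType) (E : {pred Q}) (W : seq Q) (r : nat) : Prop :=
  exists N t (f : 'I_r -> nat),
    [/\ (N <= 2 * r)%N, suffix_tree W N t, forall i, (f i < N)%N & frl E (t \o f)].

(** The arithmetic that ends [trees_left_findim], with e = (2 + c)^3: m < 2 C (r + 1) <= 4 C r gives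
    e m^3 <= 4 C e r m^2, which is below the left-hand side. *)
Lemma cubic_count (m r C e : nat) : (0 < r)%N -> (m < 2 * C * (r + 1))%N ->
  (0 < m)%N -> ((4 * C * e).+1 * (m * (r * m.+1)) <= e * m ^ 3)%N -> False.
Proof.
move=> r0 mr m0; rewrite leqNgt => /negP; apply.
have h0 : (C <= C * r)%N by rewrite leq_pmulr.
have h1 : (m <= 4 * (C * r))%N.
  by apply: ltnW; apply: leq_trans mr _; rewrite mulnDr -mulnA; lia.
have h2 : (e * m * m * m <= e * m * m * (4 * (C * r)))%N by rewrite leq_mul2l h1 orbT.
have -> : (e * m ^ 3 = e * m * m * m)%N by rewrite !expnS expn0; lia.
apply: leq_ltn_trans h2 _.
have -> : (e * m * m * (4 * (C * r)) = 4 * C * e * (m * (r * m)))%N by lia.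
rewrite mulSn -add1n; apply: leq_add; first by rewrite !muln_gt0 m0 r0.
by rewrite !leq_mul2l leqnSn !orbT.
Qed.

Section MainGrowth.
Variables (K : fieldType) (Q : unitAlgType K) (s : seq Q).
Hypothesis Qdiv : forall x : Q, x != 0 -> x \is a GRing.unit.
Local Notation V := (fun n => in_span (words s n)).
Local Notation d := (fun n => span_dim (words s n)).
Local Notation kQ := (@kscal K Q).
Let kcl : GRing.divring_closed kQ := kscal_divalg Q.
Let VE n := in_span_lspace (words s n).

Let kC k y z : k \in kQ -> y * (k * z) = k * (y * z) :> Q.
Proof. by move=> /kscalP[a ->]; rewrite !mulr_algl -scalerAr. Qed.

(** Vectors y_0, ..., y_N in V^m are sought with b y_(j + 1) = b w y_i whenever t_(j + 1) = w t_i.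
    There are (N + 1) d(m) unknowns and N d(c + m) equations, so a nonzero solution exists.
    Cancelling [b] gives y_j = t_j y_0, hence y_0 is nonzero and serves as [z]. *)
Lemma tree_stable_vector b c m N (W : seq Q) (t : nat -> Q) :
  b != 0 -> V c b -> (forall w, w \in W -> V c (b * w)) -> suffix_tree W N.+1 t ->
  (N * (d (c + m) - d m) < d m)%N ->
  exists2 z, z != 0 & forall j, (j <= N)%N -> V m (t j * z).
Proof.
move=> b0 Vb VbW [t0 tS] ltN.
have [v [Vv fv _]] := filt_dim Qdiv s m.
set n := d m in ltN v Vv fv.
have /choice[wp wpP] : forall j : 'I_N, exists wp : Q * nat,
    [/\ wp.1 \in W, (wp.2 <= j)%N & t j.+1 = wp.1 * t wp.2].
  by move=> j; have [w [i [Ww lei tE]]] := tS j (ltn_ord j); exists (w, i).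
pose w (i : 'I_N.+1 * 'I_n) (j : 'I_N) : Q :=
  (i.1 == j.+1 :> nat)%:R * (b * v i.2) - (i.1 == (wp j).2 :> nat)%:R * (b * (wp j).1 * v i.2).
have Vb2 (B : bool) y : V (c + m)%N y -> V (c + m)%N (B%:R * y).
  by case: B; rewrite ?mul1r // mul0r => _; case: (VE (c + m)%N).
have [i j||k [kK [i0 ki0] kw]] := lin_sys Qdiv kcl (w := w) (filt_dim Qdiv s (c + m)%N).
- case: (wpP j) => Ww _ _; case: (VE (c + m)%N) => _ VD VZ; apply: VD.
    by apply: Vb2; apply: filt_mul.
  rewrite -mulN1r; apply: VZ; first by rewrite (divringN kcl) ?(divring1 kcl).
  by apply: Vb2; apply: filt_mul => //; apply: VbW.
- rewrite card_prod !card_ord.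
  have := filt_dim_le Qdiv s (leq_addl c m); move: ltN; rewrite -/n; move: (d _) => e; nia.
pose y (i : nat) := \sum_(l < n) (if insub i is Some j then k (j, l) else 0) * v l.
have yE (i : 'I_N.+1) : y i = \sum_l k (i, l) * v l by apply: eq_bigr => l _; rewrite valK.
have Vy (i : 'I_N.+1) : V m (y i).
  by rewrite yE; apply: lspace_sum (VE m) _ _ => // l.
have sumE (i : 'I_N.+1) u : \sum_(p : 'I_N.+1 * 'I_n) k p * ((p.1 == i :> nat)%:R * (u * v p.2)) = u * y i.
  rewrite sum_pairE (bigD1 i) //= [X in _ + X]big1 ?addr0 => [|i' ne]; last first.
    by apply: big1 => l _; rewrite -val_eqE /= in ne; rewrite (negbTE ne) mul0r mulr0.
  by rewrite yE mulr_sumr; apply: eq_bigr => l _; rewrite eqxx mul1r -kC.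
have yS (j : 'I_N) : y j.+1 = (wp j).1 * y (wp j).2.
  have := kw j; rewrite /w; under eq_bigr => p _ do rewrite mulrBr.
  have ltp : ((wp j).2 < N.+1)%N by case: (wpP j) => _ lej _; apply: leq_trans lej _; apply: ltnW.
  rewrite sumrB (sumE (lift ord0 j)) (sumE (Ordinal ltp)) /=.
  move/eqP; rewrite subr_eq0 -mulrA => /eqP/(mulrI (Qdiv b0)).
  by rewrite /bump /= add1n.
have yt i : (i <= N)%N -> y i = t i * y 0%N.
  elim/ltn_ind: i => -[|i] IH lei; first by rewrite t0 mul1r.
  rewrite (yS (Ordinal lei)); case: (wpP (Ordinal lei)) => _ /= lej ->.
  by rewrite IH ?mulrA //; lia.
exists (y 0%N) => [|i lei]; last by rewrite -yt //; apply: (Vy (Ordinal (lei : i < N.+1)%N)).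
apply: contraNneq ki0 => y0; case: i0 => i l; apply/eqP.
apply: (fv (fun l => k (i, l))) => [l'|]; first exact: kK.
by rewrite -yE yt ?y0 ?mulr0 // -ltnS.
Qed.

Hypothesis slow : forall c N, exists2 m, (N <= m)%N & (m * (d (m + c) - d m) <= 15 * c * d m)%N.
Hypothesis cubic : forall M, exists n0, forall n, (n0 <= n)%N -> (M * d n <= n ^ 3)%N.
Hypothesis QA : is_quotient_ring (gen_alg s).

Lemma trees_left_findim (D : {pred Q}) x (W : seq Q) :
  divalg_closed D -> x \in D -> transc x -> (forall w, w \in W -> w \in D) ->
  (forall r, (0 < r)%N -> tree_rank_ge (adjoin x) W r) -> left_findim D.
Proof.
move=> Dcl Dx tx WD trees; apply: contrapT => nfD.
have [b [c [b0 Vb VbxW]]] := common_left_denominator Qdiv slow QA (x :: W).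
have Vbx : V c (b * x) by apply: VbxW; rewrite inE eqxx.
have VbW w : w \in W -> V c (b * w) by move=> Ww; apply: VbxW; rewrite inE Ww orbT.
(* [C] exceeds 15 c, so that a tree of at most 2 r <= m / C words meets the counting hypothesis of
   [tree_stable_vector]; [M] is what [cubic_count] requires. Taking m >= n0 + 2 C makes the cubic
   bound available and [r] positive. *)
pose C := (15 * c).+1; pose M := (4 * C * (2 + c) ^ 3).+1.
have [n0 cub] := cubic M.
have [m lem mk] := slow c (n0 + 2 * C).
pose r := (m %/ (2 * C))%N.
have C0 : (0 < 2 * C)%N by [].
have r0 : (0 < r)%N by rewrite divn_gt0 // (leq_trans _ lem) // leq_addl.
have rm : (2 * C * r <= m)%N by rewrite mulnC leq_trunc_div.
have mr : (m < 2 * C * (r + 1))%N by rewrite mulnC addn1 ltn_ceil.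
have [N [t [f [leN tree fN ft]]]] := trees r r0.
case: N leN tree fN => [|N] leN tree fN; first by have := fN (Ordinal r0).
have ltN : (N * (d (c + m) - d m) < d m)%N.
  have := filt_dim_gt0 Qdiv s m; move: mk; rewrite (addnC m c) /=.
  move: (_ - _)%N => k; move: (span_dim (words s m)) => e.
  rewrite /C in rm C0 *; case: k => [|k]; first by rewrite !muln0.
  by nia.
have [z z0 Vz] := tree_stable_vector b0 Vb VbW tree ltN.
have [u [Vu fu]] := filt_rank_growth Qdiv QA Dcl nfD z0.
have Ecl := adjoin_divalg Qdiv tx.
have ED e : e \in adjoin x -> e \in D by apply: adjoin_sub.
have tD j : (j <= N)%N -> t j \in D.
  case: tree => t0 tS; elim/ltn_ind: j => -[|j] IH lej; first by rewrite t0 (divring1 Dcl).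
  have [w [i [/WD Dw lei ->]]] := tS j lej.
  by rewrite (divringM Dcl) ?IH //; lia.
pose T (p : 'I_r * 'I_m.+1) := t (f p.1) * (z * u p.2).
have fT : frl (adjoin x) T.
  move=> k kE; rewrite sum_pairE exchange_big /=.
  under eq_bigr => j _.
    under eq_bigr => i _ do rewrite /T /= mulrA.
    rewrite -mulr_suml; over.
  move/(fu m.+1) => h [i j]; apply: (ft (fun i => k (i, j))) => [i'|]; first exact: kE.
  apply: h => j'; apply: (divring_sum Dcl) => i' _; apply: (divringM Dcl); first exact: ED.
  by apply: tD; rewrite -ltnS fN.
have VT p : V (2 * m)%N (T p).
  rewrite /T mulrA mul2n -addnn; apply: filt_mul; first by apply: Vz; rewrite -ltnS fN.
  by apply: filt_le (Vu _); rewrite -ltnS.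
pose T' (i : 'I_#|{: 'I_r * 'I_m.+1}|) := T (enum_val i).
have fT' : frl (adjoin x) T' by apply: frl_reindex => //; apply: enum_val_bijective.
(* The same free family lies in every step of the filtration from V^(2 m) on, so each further c
   steps add r (m + 1) to the dimension. *)
have grow j : (j * (r * m.+1) <= d (2 * m + j * c))%N.
  elim: j => [|j IH]; first by rewrite mul0n.
  have : (d (2 * m + j * c) + #|{: 'I_r * 'I_m.+1}| <= d (c + (2 * m + j * c)))%N.
    apply: (adjoin_rank_growth Qdiv tx b0 Vb Vbx _ fT') => i.
    by apply: filt_le (VT _); apply: leq_addr.
  rewrite card_prod !card_ord; have -> : (2 * m + j.+1 * c = c + (2 * m + j * c))%N by lia.
  by apply: leq_trans; rewrite mulSn addnC leq_add2r.
have := grow m; have -> : (2 * m + m * c = (2 + c) * m)%N by lia.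
move=> g; have := cub ((2 + c) * m)%N _.
have lem0 : (n0 <= m)%N by apply: leq_trans lem; apply: leq_addr.
move=> /(_ (leq_trans lem0 (leq_pmull _ _))) -/(_ isT) h.
move: (leq_trans (leq_mul (leqnn M) g) h); rewrite expnMn; apply: cubic_count => //.
by apply: leq_trans lem; rewrite addn_gt0 C0 orbT.
Qed.

End MainGrowth.

(** * Trees in a noncommutative subalgebra *)

Section AdjoinSpan.
Variables (K : fieldType) (Q : unitAlgType K).
Hypothesis Qdiv : forall x : Q, x != 0 -> x \is a GRing.unit.

(** The span of the b x^i, i < L, is stable under right multiplication by polynomials in x and,
    being finite dimensional over [S], under division by nonzero ones. [S] will be K(x) in one use
    and K(t), with b = 1, in another. *)
Lemma spn_mul_adjoin (S : {pred Q}) (x b : Q) L :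
  divalg_closed S -> transc x -> b != 0 ->
  spn S (fun i : 'I_L => b * x ^+ i) (b * x ^+ L) ->
  forall e, e \in adjoin x -> spn S (fun i : 'I_L => b * x ^+ i) (b * e).
Proof.
move=> Scl tx b0; set B := fun L => spn S (fun i : 'I_L => b * x ^+ i).
rewrite -/(B L) => BL.
have lB : lspace S (B L) := spn_lspace Scl _.
have [B0 BD BZ] := lB.
have Bx y : B L y -> B L (y * x).
  apply: (spn_sub (X := fun y => B L (y * x))).
    split=> [|y1 y2|c y1 cE]; first by rewrite mul0r.
      by rewrite mulrDl; apply: BD.
    by rewrite -mulrA; apply: BZ.
  move=> i; rewrite -mulrA -exprSr; have [lti|lei] := ltnP i.+1 L.
    exact: (spn_gen Scl _ (Ordinal lti)).
  by have -> : i.+1 = L by apply/eqP; rewrite eqn_leq lei ltn_ord.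
have Bp p y : B L y -> B L (y * horner_alg x p).
  move=> By; rewrite (@horner_algE _ _ x p (size p)) // mulr_sumr.
  have Byx i : B L (y * x ^+ i).
    by elim: i => [|i IH]; rewrite ?mulr1 // exprSr mulrA; apply: Bx.
  elim/big_rec: _ => // i z _ Bz; apply: BD => //.
  by rewrite -scalerAr -mulr_algl; apply: BZ => //; apply: divalgA.
have [n _ dB] := fdim_spanned Qdiv Scl (fun y (By : B L y) => By).
have Bb : B L b.
  case: L BL {lB B0 BD BZ Bx Bp dB} => [[c [_ /eqP]]|L _].
    by rewrite big_ord0 mulr1 (negbTE b0).
  by have := spn_gen Scl (fun i : 'I_L.+1 => b * x ^+ i) ord0; rewrite /= expr0 mulr1.
move=> e /adjoinP[p [q [q0 ->]]]; rewrite -/(B L _) mulrA.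
by apply: (fdim_mulr_onto Qdiv Scl lB dB) => [|y|]; [apply: transc_neq0|apply: Bp|apply: Bp].
Qed.

End AdjoinSpan.

Section TreeDichotomy.
Variables (K : fieldType) (Q : unitAlgType K).
Hypothesis Qdiv : forall x : Q, x != 0 -> x \is a GRing.unit.
Variables (D : {pred Q}) (x b : Q).
Hypotheses (Dcl : divalg_closed D) (Dx : x \in D) (Db : b \in D) (tx : transc x) (b0 : b != 0).
Local Notation E := (adjoin x).
Let Ecl : GRing.divring_closed E := adjoin_divalg Qdiv tx.
Local Notation B L := (spn E (fun i : 'I_L => b * x ^+ i)).

Lemma free_powers_tree r : (0 < r)%N ->
  frl E (fun i : 'I_r => b * x ^+ i) -> tree_rank_ge E [:: x; b] r.
Proof.
move=> r0 fb; exists (2 * r)%N, (fun j => if (j < r)%N then x ^+ j else b * x ^+ (j - r)).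
exists (fun i => r + i)%N; split=> //; last 1 first.
- congr frl : fb; apply/funext => i /=.
  by rewrite ltnNge leq_addr /= addKn.
- split=> [|j ltj]; first by rewrite r0.
  have [ltjr|lerj] := ltnP j.+1 r.
    by exists x, j; rewrite inE eqxx (ltnW ltjr) exprS.
  exists b, (j.+1 - r)%N; rewrite !inE eqxx orbT; split=> //; first by lia.
  by have -> : (j.+1 - r < r)%N by lia.
by move=> i; have := ltn_ord i; lia.
Qed.

(** [D0] consists of the q with q F inside [F]. It is a ring that embeds in [F] by q -> q 1, so it
    is finite dimensional over K(x); right multiplication by a nonzero element is then onto, and
    inverses stay in [D0]. *)
Lemma finite_extension (F : Q -> Prop) (I : finType) (t : I -> Q) :
  lspace E F -> (forall y, F y -> spn E t y) -> F 1 -> (forall y, F y -> F (b * y)) ->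
  exists D0 : {pred Q}, [/\ divalg_closed D0, x \in D0, b \in D0
    & exists n, fdim E (fun y => y \in D0) n].
Proof.
move=> lF Ft F1 Fb; have [F0 FD FZ] := lF.
pose D0 : {pred Q} := fun q => `[< forall y, F y -> F (q * y) >].
have D0P q : reflect (forall y, F y -> F (q * y)) (q \in D0) by apply: asboolP.
have ED0 e : e \in E -> e \in D0 by move=> Ee; apply/D0P => y; apply: FZ.
have D0F q : q \in D0 -> F q by move=> /D0P/(_ 1 F1); rewrite mulr1.
have [n _ dD0] := fdim_spanned Qdiv Ecl (fun q (D0q : q \in D0) => Ft _ (D0F q D0q)).
have D0D y z : y \in D0 -> z \in D0 -> y + z \in D0.
  by move=> /D0P Fy /D0P Fz; apply/D0P => u Fu; rewrite mulrDl; apply: FD; [apply: Fy|apply: Fz].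
have D0M y z : y \in D0 -> z \in D0 -> y * z \in D0.
  by move=> /D0P Fy /D0P Fz; apply/D0P => u Fu; rewrite -mulrA; apply/Fy/Fz.
have lD0 : lspace E (fun y => y \in D0).
  split=> [||c y /ED0 cD0]; [exact/ED0/(divring0 Ecl)|exact: D0D|exact: D0M].
exists D0; split.
- apply: divalg_closedP => //; first exact/ED0/(divring1 Ecl).
    move=> k y D0y; rewrite -mulr_algl; apply: D0M => //.
    by apply/ED0/divalgA/adjoin_divalg.
  move=> y D0y y0; rewrite -div1r; apply: (fdim_mulr_onto Qdiv Ecl lD0 dD0) => // [z D0z|].
    exact: D0M.
  exact/ED0/(divring1 Ecl).
- exact/ED0/adjoin_gen.
- exact/D0P.
by exists n.
Qed.

Lemma tree_dichotomy :
  (exists W : seq Q, (forall w, w \in W -> w \in D) /\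
     forall r, (0 < r)%N -> tree_rank_ge E W r) \/
  (exists D0 : {pred Q}, [/\ divalg_closed D0, x \in D0, b \in D0
    & exists n, fdim E (fun y => y \in D0) n]).
Proof.
have [free|] := EM (forall n, frl E (fun i : 'I_n => b * x ^+ i)).
  left; exists [:: x; b]; split=> [w|r r0]; first by rewrite !inE => /orP[]/eqP->.
  exact: free_powers_tree.
move/existsNP => [n nfree].
have [L BL] : exists L, B L (b * x ^+ L).
  apply: contrapT => H; apply: nfree.
  by apply: (frl_extend_all Qdiv Ecl (v := fun i => b * x ^+ i)) => i _ Bi; apply: H; exists i.
(* Coefficients in K(x) stand on the left and need not commute with [b]. As b K(x) lies in the left
   span of the letters b x^i, a span of words is stable under [b] as soon as it contains every
   letter times each of these words. *)
pose W := [seq b * x ^+ i | i <- iota 0 L].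
have WP i : (i < L)%N -> b * x ^+ i \in W.
  by move=> lti; apply/mapP; exists i; rewrite // mem_iota.
pose T r := exists2 t, suffix_tree W r t & frl E (fun j : 'I_r => t j).
have [allT|] := EM (forall r, T r.+1).
  left; exists W; split=> [w /mapP[i _ ->]|[//|r] _]; first by rewrite (divringM Dcl) ?divalgX.
  by have [t tT ft] := allT r; exists r.+1, t, (fun i => i); split=> //; lia.
move/existsNP => [n0 nT].
have T1 : T 1%N.
  exists (fun=> 1); first by split=> // j; rewrite ltnS ltn0.
  by move=> c _; rewrite big_ord1 mulr1 => c0 i; rewrite ord1.
have [r [t tT ft] nTr] : exists2 r, T r.+1 & ~ T r.+2.
  apply: contrapT => H; apply: nT; elim: n0 => // m IH.
  by apply: contrapT => nTm; apply: H; exists m.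
pose F := spn E (fun j : 'I_r.+1 => t j).
have lF : lspace E F := spn_lspace Ecl _.
have FW w (j : 'I_r.+1) : w \in W -> F (w * t j).
  move=> Ww; apply: contrapT => nF; apply: nTr.
  exists (fun i => if (i < r.+1)%N then t i else w * t j).
    case: tT => t0 tS; split=> // i lti.
    have [lti'|lei] := ltnP i.+1 r.+1.
      have [w' [i' [Ww' lei' tE]]] := tS i lti'; exists w', i'; split=> //.
      by rewrite (leq_ltn_trans lei') // ltnW.
    by exists w, j; rewrite ltn_ord; split=> //; have := ltn_ord j; lia.
  have := frl_extend Qdiv Ecl ft nF; congr frl; apply/funext => i.
  case: (unliftP ord_max i) => [k|] ->; last by rewrite extend_max /= ltnn.
  by rewrite extend_lift lift_max ltn_ord.
have F1 : F 1 by case: tT => <- _; exact: (spn_gen Ecl (fun j : 'I_r.+1 => t j) ord0).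
have [F0 FD FZ] := lF.
right; apply: (finite_extension lF (t := fun j : 'I_r.+1 => t j)) => // y.
move=> [c [cE ->]]; rewrite mulr_sumr; elim/big_rec: _ => [//|j z _ Fz]; apply: FD => //.
rewrite mulrA; apply: (spn_sub (X := fun u => F (u * t j))) (spn_mul_adjoin Qdiv (adjoin_divalg Qdiv tx) tx b0 BL (cE j)).
  case: lF => {}F0 {}FD {}FZ; split=> [|u1 u2|e u eE]; first by rewrite mul0r.
    by rewrite mulrDl; apply: FD.
  by rewrite -mulrA; apply: FZ.
by move=> i; apply/FW/WP.
Qed.

End TreeDichotomy.

(** * Common zeros of forms *)

Section GradedIdeals.
Variables (K : closedFieldType) (R : comAlgType K) (n : nat) (T : 'I_n -> R).

(** The values at [T] of the forms of degree [k]. [R] behaves as a polynomial ring only once the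
    monomials in [T] are assumed independent, in the proof of properness. *)
Fixpoint hpart (k : nat) (r : R) : Prop :=
  if k is k'.+1 then exists g : 'I_n -> R, (forall i, hpart k' (g i)) /\ r = \sum_i T i * g i
  else exists c : K, r = c%:A.

Definition subsp (X : R -> Prop) : Prop :=
  [/\ X 0, forall x y, X x -> X y -> X (x + y) & forall c x, X x -> X (c *: x)].

Lemma subsp_sum X (I : Type) (r : seq I) (P : pred I) (F : I -> R) :
  subsp X -> (forall i, P i -> X (F i)) -> X (\sum_(i <- r | P i) F i).
Proof. by move=> [X0 XD _] XF; elim/big_rec: _ => // i x Pi; apply: XD; apply: XF. Qed.

Lemma subspB X x y : subsp X -> X x -> X y -> X (x - y).
Proof. by move=> [_ XD XZ] Xx Xy; rewrite -scaleN1r; apply: XD => //; apply: XZ. Qed.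

Lemma hpart_subsp k : subsp (hpart k).
Proof.
elim: k => [|k [H0 HD HZ]] /=.
  split=> [|x y [c ->] [d ->]|a x [c ->]]; first by exists 0; rewrite scale0r.
    by exists (c + d); rewrite scalerDl.
  by exists (a * c); rewrite scalerA.
split=> [|x y [g [gH ->]] [h [hH ->]]|a x [g [gH ->]]].
- by exists (fun=> 0); split=> //; rewrite big1 // => i _; rewrite mulr0.
- exists (fun i => g i + h i); split=> [i|]; first exact: HD.
  by rewrite -big_split; apply: eq_bigr => i _; rewrite mulrDr.
exists (fun i => a *: g i); split=> [i|]; first exact: HZ.
by rewrite scaler_sumr; apply: eq_bigr => i _; rewrite scalerAr.
Qed.

Lemma hpart_gen k i r : hpart k r -> hpart k.+1 (T i * r).
Proof.
move=> Hr; have [H0 _ _] := hpart_subsp k.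
exists (fun j => if j == i then r else 0); split=> [j|]; first by case: eqP.
by rewrite (bigD1 i) //= eqxx big1 ?addr0 // => j /negbTE->; rewrite mulr0.
Qed.

Definition lform (v : 'rV[K]_n) : R := \sum_i v 0 i *: T i.

Lemma lformB v w c : lform (v - c *: w) = lform v - c *: lform w.
Proof.
rewrite /lform scaler_sumr -sumrB; apply: eq_bigr => i _.
by rewrite !mxE scalerBl scalerA.
Qed.

Lemma lformD v w : lform (v + w) = lform v + lform w.
Proof. by rewrite /lform -big_split; apply: eq_bigr => i _; rewrite mxE scalerDl. Qed.

Lemma lform_delta i : lform (delta_mx 0 i) = T i.
Proof.
rewrite /lform (bigD1 i) //= mxE !eqxx scale1r big1 ?addr0 // => j ne.
by rewrite mxE (negbTE ne) andbF scale0r.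
Qed.

Lemma lform_mul (X Y : R -> Prop) v r :
  subsp Y -> (forall i r, X r -> Y (T i * r)) -> X r -> Y (lform v * r).
Proof.
move=> sY XY Xr; rewrite mulr_suml; apply: subsp_sum => // i _.
by rewrite -scalerAl; case: sY => _ _; apply; apply: XY.
Qed.

Lemma hpart_lform k v r : hpart k r -> hpart k.+1 (lform v * r).
Proof. by apply: lform_mul; [apply: hpart_subsp|move=> i r'; apply: hpart_gen]. Qed.

Lemma hpart1 r : hpart 1 r -> exists v, r = lform v.
Proof.
move=> [g [gH ->]]; have /choice[c cE] : forall i, exists c : K, g i = c%:A by exact: gH.
exists (\row_i c i); apply: eq_bigr => i _.
by rewrite mxE cE mulr_algr.
Qed.

Definition gideal (J : nat -> R -> Prop) : Prop :=
  forall k, subsp (J k) /\ forall i r, J k r -> J k.+1 (T i * r).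

(** No degree is exhausted, so the ideal contains no power of the irrelevant ideal: the condition
    for a projective zero. *)
Definition proper_graded (J : nat -> R -> Prop) : Prop :=
  forall k, exists r, hpart k r /\ ~ J k r.

Definition add_form (J : nat -> R -> Prop) (v : 'rV[K]_n) (k : nat) (r : R) : Prop :=
  if k is k'.+1 then exists r1 r2, [/\ J k r1, hpart k' r2 & r = r1 + lform v * r2]
  else J 0%N r.

Lemma gideal_lform J k v r : gideal J -> J k r -> J k.+1 (lform v * r).
Proof. by move=> gJ; apply: lform_mul; [case: (gJ k.+1)|case: (gJ k)]. Qed.

Lemma add_form_gideal J v : gideal J -> gideal (add_form J v).
Proof.
move=> gJ [|k] /=; split.
- by case: (gJ 0%N).
- move=> i r Jr; exists (T i * r), 0; case: (gJ 0%N) => _ JT.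
  by split; [apply: JT|case: (hpart_subsp 0)|rewrite mulr0 addr0].
- have [[J0 JD JZ] _] := gJ k.+1; have [H0 HD HZ] := hpart_subsp k.
  split=> [|x y [x1 [x2 [Jx Hx ->]]] [y1 [y2 [Jy Hy ->]]]|c x [x1 [x2 [Jx Hx ->]]]].
  + by exists 0, 0; rewrite mulr0 addr0.
  + by exists (x1 + y1), (x2 + y2); split; [apply: JD|apply: HD|rewrite mulrDr addrACA].
  + by exists (c *: x1), (c *: x2); split; [apply: JZ|apply: HZ|rewrite scalerDr scalerAr].
move=> i r [r1 [r2 [Jr1 Hr2 ->]]]; exists (T i * r1), (T i * r2); split.
- by case: (gJ k.+1) => _; apply.
- exact: hpart_gen.
- by rewrite mulrDr mulrCA.
Qed.

Lemma add_form_sub J v k r : gideal J -> J k r -> add_form J v k r.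
Proof.
move=> gJ; case: k => //= k Jr; exists r, 0.
by rewrite mulr0 addr0; split=> //; case: (hpart_subsp k).
Qed.

Lemma full_above J k0 k : gideal J -> (forall r, hpart k0 r -> J k0 r) ->
  (k0 <= k)%N -> forall r, hpart k r -> J k r.
Proof.
move=> gJ full /subnKC <-; elim: (k - k0)%N => [|j IH]; first by rewrite addn0.
rewrite addnS => r [g [gH ->]]; have [sJ _] := gJ (k0 + j).+1.
by apply: subsp_sum => // i _; case: (gJ (k0 + j)%N) => _; apply; apply: IH; apply: gH.
Qed.

(** Not the usual saturation: geometrically, each hyperplane whose form is outside [J] misses the
    zero set, since only finitely many degrees survive modulo [J] and that form. *)
Definition saturated (J : nat -> R -> Prop) : Prop :=
  forall v, ~ J 1%N (lform v) ->
  exists k0, forall k, (k0 <= k)%N -> forall r, hpart k.+1 r ->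
    exists r1 r2, [/\ J k.+1 r1, hpart k r2 & r = r1 + lform v * r2].

(** A linear form that violates the condition can be adjoined without losing properness. Only linear
    forms are adjoined, so the rank of the space [A] of those already in the ideal bounds the number
    of steps. *)
Lemma saturate J : gideal J -> proper_graded J ->
  exists J', [/\ gideal J', proper_graded J', saturated J' & forall k r, J k r -> J' k r].
Proof.
move=> gJ pJ.
suff H p (A : 'M[K]_n) (J1 : nat -> R -> Prop) : (n - \rank A <= p)%N -> gideal J1 ->
    proper_graded J1 -> (forall v : 'rV_n, (v <= A)%MS -> J1 1%N (lform v)) ->
    exists J', [/\ gideal J', proper_graded J', saturated J' & forall k r, J1 k r -> J' k r].
  apply: (H _ 0 J (leqnn _)) => // v; rewrite submx0 => /eqP->.
  by rewrite /lform big1 => [|i _]; [case: (gJ 1%N) => -[]|rewrite mxE scale0r].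
elim: p A J1 => [|p IH] A J1 rA g1 p1 A1.
  exists J1; split=> // v; case; apply: A1; apply: submx_full.
  by rewrite /row_full eqn_leq rank_leq_col /= -subn_eq0 -leqn0.
have [sat|nsat] := EM (saturated J1); first by exists J1.
move/existsNP: nsat => [v /not_implyP[nv /forallNP nk]].
have gv := add_form_gideal v g1.
have pv : proper_graded (add_form J1 v).
  move=> k; apply: contrapT => /forallNP H; apply: (nk k) => k' lek r Hr.
  suff : add_form J1 v k'.+1 r by [].
  apply: (full_above gv (k0 := k)) Hr => //; last exact: leqW.
  by move=> r' Hr'; apply: contrapT => nr'; apply: (H r').
have nvA : ~~ (v <= A)%MS by apply/negP => /A1.
have [|w|J' [gJ' pJ' sJ' J1J']] := IH (A + v)%MS (add_form J1 v) _ gv pv.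
- have : (\rank A < \rank (A + v)%MS)%N.
    rewrite ltn_neqAle mxrankS ?addsmxSl // andbT; apply/eqP => e.
    have /mxrank_leqif_eq := addsmxSl A v; case; rewrite e eqxx => _ /esym.
    move=> /andP[_ le]; by rewrite (submx_trans (addsmxSr A v) le) in nvA.
  by lia.
- move=> /sub_addsmxP[[a b] /= ->]; rewrite lformD.
  have [_ HD HZ] := hpart_subsp 1.
  exists (lform (a *m A)), (b 0 0)%:A; split; first exact/A1/submxMl.
    by exists (b 0 0).
  congr (_ + _); rewrite mulr_algr /lform scaler_sumr; apply: eq_bigr => i _.
  by rewrite mxE big_ord1 scalerA.
by exists J'; split=> // k r J1r; apply/J1J'/add_form_sub.
Qed.

End GradedIdeals.

(** * Projective zeros of saturated ideals *)

Section Points.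
Variables (K : closedFieldType) (R : comAlgType K) (n : nat) (T : 'I_n -> R).
Local Notation hpart := (hpart T).
Local Notation lform := (lform T).

Definition span_mod (J X : R -> Prop) h (rho : 'I_h -> R) : Prop :=
  forall r, X r -> exists c : 'I_h -> K, J (r - \sum_i c i *: rho i).

Lemma hpart_finite k : exists (I : finType) (rho : I -> R), (forall i, hpart k (rho i)) /\
  forall r, hpart k r -> exists c : I -> K, r = \sum_i c i *: rho i.
Proof.
elim: k => [|k [I [rho [rhoH rhoS]]]].
  exists 'I_1, (fun=> 1); split=> [_|r [c ->]]; first by exists 1; rewrite scale1r.
  by exists (fun=> c); rewrite big_ord1.
exists ('I_n * I)%type, (fun p => T p.1 * rho p.2); split=> [p|r [g [gH ->]]].
  exact: hpart_gen.
have /choice[c cE] : forall i, exists c : I -> K, g i = \sum_j c j *: rho j.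
  by move=> i; apply: rhoS; apply: gH.
exists (fun p => c p.1 p.2).
rewrite -(pair_bigA _ (fun i j => c i j *: (T i * rho j))) /=; apply: eq_bigr => i _.
by rewrite cE mulr_sumr; apply: eq_bigr => j _; rewrite scalerAr.
Qed.

Lemma span_mod_finite (J : R -> Prop) k : J 0 ->
  exists h (rho : 'I_h -> R), (forall i, hpart k (rho i)) /\ span_mod J (hpart k) rho.
Proof.
move=> J0; have [I [rho [rhoH rhoS]]] := hpart_finite k.
exists #|I|, (fun i => rho (enum_val i)); split=> [i|r /rhoS[c ->]]; first exact: rhoH.
exists (fun i => c (enum_val i)).
rewrite (reindex (fun i : 'I_#|I| => enum_val i)) /= ?subrr //.
by exists enum_rank => x _; rewrite ?enum_valK ?enum_rankK.
Qed.

Variable J : nat -> R -> Prop.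
Hypotheses (gJ : gideal T J) (pJ : proper_graded T J) (sJ : saturated T J).

Let J0 k : J k 0. Proof. by case: (gJ k) => -[]. Qed.
Let JD k x y : J k x -> J k y -> J k (x + y). Proof. by case: (gJ k) => -[_ H _] _; apply: H. Qed.
Let JZ k c x : J k x -> J k (c *: x). Proof. by case: (gJ k) => -[_ _ H] _; apply: H. Qed.
Let JB k x y : J k x -> J k y -> J k (x - y).
Proof. by case: (gJ k) => H _; apply: subspB. Qed.
Let Jl k v x : J k x -> J k.+1 (lform v * x). Proof. exact: gideal_lform. Qed.

Let span_mod_step k u h (rho : 'I_h -> R) :
  (forall r, hpart k.+1 r -> exists r1 r2, [/\ J k.+1 r1, hpart k r2 & r = r1 + lform u * r2]) ->
  span_mod (J k) (hpart k) rho ->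
  span_mod (J k.+1) (hpart k.+1) (fun i => lform u * rho i).
Proof.
move=> sat sp r /sat[r1 [r2 [Jr1 /sp[c Jc] ->]]]; exists c.
have -> : r1 + lform u * r2 - \sum_i c i *: (lform u * rho i) =
    r1 + lform u * (r2 - \sum_i c i *: rho i).
  rewrite mulrBr addrA mulr_sumr; congr (_ - _).
  by apply: eq_bigr => i _; rewrite scalerAr.
by apply: JD => //; apply: Jl.
Qed.

(* A linear form eventually surjective modulo [J] permutes a minimal spanning family;
   an eigenvector of a second form relative to it then drops the number of generators. *)
Lemma proportional_forms u v : ~ J 1%N (lform u) ->
  exists lam : K, J 1%N (lform v - lam *: lform u).
Proof.
move=> nu; apply: contrapT => /forallNP nlam.
have [ku kuP] := sJ nu.
(* The degree [k] is left free: from [ku] on, multiplication by [lform u] carries spanning families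
   to spanning families, so a smaller family in any such degree contradicts minimality. *)
pose N h := `[< exists k (rho : 'I_h -> R), [/\ (ku <= k)%N, forall i, hpart k (rho i)
   & span_mod (J k) (hpart k) rho] >].
have exN : exists h, N h.
  have [h [rho [rH rS]]] := span_mod_finite ku (J0 ku).
  by exists h; apply/asboolP; exists ku, rho.
case: (ex_minnP exN) => -[|h] /asboolP[k [rho [lek rH rS]]] minh.
  have [r [Hr nJr]] := pJ k; apply: nJr.
  by have [c] := rS r Hr; rewrite big_ord0 subr0.
have pow j : (forall i, hpart (k + j) (lform u ^+ j * rho i)) /\
    span_mod (J (k + j)) (hpart (k + j)) (fun i => lform u ^+ j * rho i).
  elim: j => [|j [IH1 IH2]].
    rewrite addn0; split=> [i|]; first by rewrite mul1r.
    by move=> r /rS[c Jc]; exists c; under eq_bigr => i _ do rewrite mul1r.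
  rewrite addnS; split=> [i|]; first by rewrite exprS -mulrA; apply: hpart_lform.
  move=> r Hr; have [|c Jc] := span_mod_step (u := u) _ IH2 Hr.
    by apply: kuP; apply: leq_trans lek _; apply: leq_addr.
  by exists c; under eq_bigr => i _ do rewrite exprS -mulrA.
have /choice[A AP] : forall i, exists A : 'I_h.+1 -> K,
    J k.+1 (lform v * rho i - \sum_j A j *: (lform u * rho j)).
  move=> i; have [|c Jc] := span_mod_step (u := u) (kuP k lek) rS (r := lform v * rho i).
    exact: hpart_lform.
  by exists c.
pose M := \matrix_(i, j) A i j.
have [lam] : exists lam, root (char_poly M) lam.
  by apply/closed_rootP; rewrite size_char_poly.
rewrite -eigenvalue_root_char => /eigenvalueP[y yM y0].
have [i0 yi0] : exists i0, y 0 i0 != 0.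
  apply: contrapT => /forallNP H; case/eqP: y0; apply/rowP => i; rewrite mxE.
  by apply/eqP/negPn/negP => /H.
pose w := v - lam *: u; pose b := \sum_i y 0 i *: rho i.
have nw : ~ J 1%N (lform w) by rewrite lformB.
have Jb : J k.+1 (lform w * b).
  have -> : lform w * b =
      \sum_i y 0 i *: (lform v * rho i - \sum_j A i j *: (lform u * rho j)).
    rewrite lformB mulrBl /b mulr_sumr -scalerAl mulr_sumr.
    under [RHS]eq_bigr => i _ do rewrite scalerBr.
    rewrite sumrB; congr (_ - _); first by apply: eq_bigr => i _; rewrite scalerAr.
    rewrite scaler_sumr; under [RHS]eq_bigr => i _ do rewrite scaler_sumr.
    rewrite exchange_big /=; apply: eq_bigr => j _.
    under eq_bigr => i _ do rewrite scalerA.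
    rewrite -scaler_suml -scalerAr scalerA.
    move/rowP: yM => /(_ j); rewrite !mxE => <-; congr (_ *: _).
    by apply: eq_bigr => i _; rewrite mxE.
  by case: (gJ k.+1) => sJk _; apply: subsp_sum => // i _; apply: JZ.
(* [lform w] is eventually onto too, so its products with the family moved up by u^kw span. The
   vanishing of w u^kw b modulo [J] expresses the product with index [i0] through the others. *)
have [kw kwP] := sJ nw.
suff /minh : N h by rewrite ltnn.
have [rHj rSj] := pow kw; pose kk := (k + kw)%N.
have Jub : J kk.+1 (lform w * (lform u ^+ kw * b)).
  rewrite mulrCA /kk -addSn; elim: (kw) => [|j IH]; first by rewrite mul1r addn0.
  by rewrite exprS -mulrA addnS; apply: Jl.
pose rho' i := lform w * (lform u ^+ kw * rho (lift i0 i)).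
apply/asboolP; exists kk.+1, rho'; split=> [|i|r Hr].
- by apply: leqW; apply: leq_trans lek _; apply: leq_addr.
- by apply: hpart_lform; apply: rHj.
have [|c Jc] := span_mod_step (u := w) _ rSj Hr; first by apply: kwP; apply: leq_addl.
exists (fun i => c (lift i0 i) - c i0 * (y 0 i0)^-1 * y 0 (lift i0 i)).
have -> : r - \sum_i (c (lift i0 i) - c i0 * (y 0 i0)^-1 * y 0 (lift i0 i)) *: rho' i =
    (r - \sum_i c i *: (lform w * (lform u ^+ kw * rho i))) +
    (c i0 * (y 0 i0)^-1) *: (lform w * (lform u ^+ kw * b)).
  rewrite -addrA; congr (_ + _); rewrite (bigD1_ord i0) //=.
  rewrite /b (bigD1_ord i0) //= mulrDr mulrDr scalerDr.
  rewrite -!scalerAr scalerA mulfVK //.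
  under eq_bigr => i _ do rewrite scalerBl.
  rewrite sumrB opprB opprD -addrA addrCA addKr addrC; congr (_ - _).
  rewrite !mulr_sumr scaler_sumr; apply: eq_bigr => i _.
  by rewrite -!scalerAr scalerA.
by apply: JD => //; apply: JZ.
Qed.

(** Modulo [J] each T_i is z_i u for one linear form u, so a monomial of degree m is its value at z
    times u^m. No power of u lies in [J], since the whole degree would follow; so forms in [J]
    vanish at z. Forms are sums over words of length m, the shape in which determinants expand. *)
Lemma projective_point : exists z : 'I_n -> K, [/\ exists i, z i != 0
  & forall m (a : {ffun 'I_m -> 'I_n} -> K),
      J m (\sum_w a w *: \prod_i T (w i)) -> \sum_w a w * \prod_i z (w i) = 0].
Proof.
have full1 : ~ forall r, hpart 1 r -> J 1%N r.
  by move=> H; have [r [/H Jr nJr]] := pJ 1.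
have [u nu] : exists u, ~ J 1%N (lform u).
  apply: contrapT => /forallNP H; apply: full1 => r Hr.
  by have [v ->] := hpart1 Hr; apply: contrapT; apply: H.
have /choice[z zP] : forall i, exists z, J 1%N (T i - z *: lform u).
  by move=> i; have [lam] := proportional_forms (delta_mx 0 i) nu; rewrite lform_delta; exists lam.
have JTu k i r c : J k (r - c *: lform u ^+ k) ->
    J k.+1 (T i * r - (z i * c) *: lform u ^+ k.+1).
  move=> Jr; have -> : T i * r - (z i * c) *: lform u ^+ k.+1 =
      T i * (r - c *: lform u ^+ k) + c *: (lform u ^+ k * (T i - z i *: lform u)).
    rewrite !mulrBr scalerBr -!scalerAr scalerA -exprSr (mulrC c) [T i * _ ^+ _]mulrC.
    by rewrite addrA subrK.
  apply: JD; first by case: (gJ k) => _; apply.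
  apply: JZ; elim: k {Jr} => [|k IH]; first by rewrite mul1r.
  by rewrite exprS -mulrA; apply: Jl.
have Hu k r : hpart k r -> exists c, J k (r - c *: lform u ^+ k).
  elim: k r => [|k IH] r; first by move=> [c ->]; exists c; rewrite subrr.
  move=> [g [gH ->]]; have /choice[c cP] : forall i, exists c, J k (g i - c *: lform u ^+ k).
    by move=> i; apply: IH; apply: gH.
  exists (\sum_i z i * c i); rewrite scaler_suml -sumrB.
  by case: (gJ k.+1) => sJk _; apply: subsp_sum => // i _; apply: JTu.
have nuk k : ~ J k (lform u ^+ k).
  move=> Juk; have [r [Hr nJr]] := pJ k; apply: nJr; have [c Jc] := Hu k r Hr.
  by rewrite -(subrK (c *: lform u ^+ k) r); apply: JD => //; apply: JZ.
exists z; split.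
  apply: contrapT => /forallNP z0; apply: full1 => r [g [gH ->]].
  case: (gJ 1%N) => sJ1 _; apply: subsp_sum => // i _.
  have [c ->] := gH i; rewrite mulr_algr; apply: JZ.
  by have := zP i; have /negP/negPn/eqP-> := z0 i; rewrite scale0r subr0.
move=> m a Ja.
have mon k (w : 'I_k -> 'I_n) : J k (\prod_i T (w i) - (\prod_i z (w i)) *: lform u ^+ k).
  elim: k w => [|k IH] w; first by rewrite !big_ord0 scale1r subrr.
  by rewrite !big_ord_recl; apply: JTu; apply: IH.
apply: contrapT => /eqP s0; apply: (nuk m).
set S := \sum_w a w * _ in s0.
have JS : J m (S *: lform u ^+ m).
  rewrite -[X in J m X](subKr (\sum_w a w *: \prod_i T (w i))); apply: JB => //.
  rewrite scaler_suml -sumrB; case: (gJ m) => sJm _; apply: subsp_sum => // w _.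
  by rewrite -scalerA -scalerBr; apply: JZ; apply: mon.
by rewrite -[lform u ^+ m]scale1r -(mulVf s0) -scalerA; apply: JZ.
Qed.

End Points.

(** * Properness of an ideal generated by few forms *)

Section ProperIdeals.
Variables (K : closedFieldType) (R : comAlgType K) (n : nat) (T : 'I_n.+1 -> R).
Local Notation hpart := (hpart T).
Hypothesis indep : forall (E : finType) (e : E -> 'I_n.+1 -> nat) (c : E -> K),
  (forall x y, e x =1 e y -> x = y) ->
  \sum_x c x *: \prod_i T i ^+ e x i = 0 -> forall x, c x = 0.
Variables (M m : nat) (f : 'I_M -> R).
Hypotheses (m0 : (0 < m)%N) (ltM : (M < n)%N).

(** Below degree m the truncated k - m is 0 and would admit constant cofactors; they are required to
    vanish there. *)
Definition forms_ideal (k : nat) (r : R) : Prop := exists g : 'I_M -> R,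
  (forall q, if (m <= k)%N then hpart (k - m) (g q) else g q = 0) /\ r = \sum_q f q * g q.

Lemma forms_idealP : gideal T forms_ideal.
Proof.
move=> k; split.
  have [H0 HD HZ] := hpart_subsp T (k - m).
  split=> [|x y [g [gP ->]] [h [hP ->]]|c x [g [gP ->]]].
  - by exists (fun=> 0); split=> [q|]; [case: ifP|rewrite big1 // => q _; rewrite mulr0].
  - exists (fun q => g q + h q); split=> [q|].
      by have := gP q; have := hP q; case: ifP => _; [move=> ? ?; apply: HD|move=> -> ->; rewrite addr0].
    by rewrite -big_split; apply: eq_bigr => q _; rewrite mulrDr.
  exists (fun q => c *: g q); split=> [q|].
    by have := gP q; case: ifP => _; [apply: HZ|move=> ->; rewrite scaler0].
  by rewrite scaler_sumr; apply: eq_bigr => q _; rewrite scalerAr.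
move=> i r [g [gP ->]]; exists (fun q => T i * g q); split=> [q|].
  have := gP q; have [lemk|ltkm] := leqP m k.
    by rewrite leqW // subSn //; apply: hpart_gen.
  move=> ->; rewrite mulr0; case: ifP => // _.
  by case: (hpart_subsp T (k.+1 - m)).
by rewrite mulr_sumr; apply: eq_bigr => q _; rewrite mulrCA.
Qed.

Let hpart_finite_below k : exists (I : finType) (b : I -> R),
  forall i, (i < k)%N -> forall r, hpart i r -> exists c : I -> K, r = \sum_j c j *: b j.
Proof.
elim: k => [|k [I [b bP]]]; first by exists 'I_0, (fun=> 0).
have [I' [b' [_ b'P]]] := hpart_finite T k.
exists (I + I')%type, (fun j => match j with inl j => b j | inr j => b' j end) => i.
rewrite ltnS leq_eqVlt => /predU1P[-> r /b'P[c ->]|lti r /(bP i lti)[c ->]].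
  exists (fun j => match j with inl _ => 0 | inr j => c j end).
  by rewrite big_sumType /= [X in X + _]big1 ?add0r // => j _; rewrite scale0r.
exists (fun j => match j with inl j => c j | inr _ => 0 end).
by rewrite big_sumType /= [X in _ + X]big1 ?addr0 // => j _; rewrite scale0r.
Qed.

Section Reduction.
Variables (k1 : nat) (I : finType) (b : I -> R) (N : nat).
Hypothesis lemk1 : (m <= k1)%N.
Hypothesis bP : forall i, (i < k1)%N -> forall r, hpart i r -> exists c : I -> K, r = \sum_j c j *: b j.
Hypothesis full : forall j, (k1 <= j)%N -> forall r, hpart j r -> forms_ideal j r.

Let gen (al : 'I_M -> nat) (i : I) : R := (\prod_q f q ^+ al q) * b i.
Let X j r := exists c : {ffun 'I_M -> 'I_N} * I -> K,
  (forall p, c p != 0 -> forall q, (p.1 q <= j)%N) /\ r = \sum_p c p *: gen (fun q => p.1 q : nat) p.2.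

Let Xsub j : subsp (X j).
Proof.
split=> [|x y [c [cP ->]] [d [dP ->]]|a x [c [cP ->]]].
- exists (fun=> 0); split=> [p|]; first by rewrite eqxx.
  by rewrite big1 // => p _; rewrite scale0r.
- exists (fun p => c p + d p); split=> [p|].
    have [c0|c0 _] := eqVneq (c p) 0; last exact: cP.
    by rewrite c0 add0r; apply: dP.
  by rewrite -big_split; apply: eq_bigr => p _; rewrite scalerDl.
exists (fun p => a * c p); split=> [p|].
  by rewrite mulf_eq0 negb_or => /andP[_]; apply: cP.
by rewrite scaler_sumr; apply: eq_bigr => p _; rewrite scalerA.
Qed.

Let Xgen j al i : (j < N)%N -> (forall q, (al q <= j)%N) -> X j (gen al i).
Proof.
move=> ltj alj; pose p0 : {ffun 'I_M -> 'I_N} * I :=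
  ([ffun q => Ordinal (leq_ltn_trans (alj q) ltj)], i).
exists (fun p => (p == p0)%:R); split=> [p|].
  case: (p =P p0) => [->|_] /=; last by rewrite eqxx.
  by move=> _ q; rewrite ffunE; apply: alj.
rewrite (bigD1 p0) //= eqxx scale1r big1 ?addr0; last first.
  by move=> p /negbTE->; rewrite scale0r.
by rewrite /gen; congr (_ * _); apply: eq_bigr => q _; rewrite ffunE.
Qed.

Let Xmul j q r : (j.+1 < N)%N -> X j r -> X j.+1 (f q * r).
Proof.
move=> ltj [c [cP ->]]; rewrite mulr_sumr; apply: subsp_sum => // p _.
have [c0|c0] := eqVneq (c p) 0.
  by rewrite c0 scale0r mulr0; case: (Xsub j.+1).
rewrite -scalerAr; case: (Xsub j.+1) => _ _; apply.
have -> : f q * gen (fun q => p.1 q : nat) p.2 = gen (fun q' => p.1 q' + (q' == q))%N p.2.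
  rewrite /gen mulrA; congr (_ * _).
  under [RHS]eq_bigr => q' _ do rewrite exprD.
  rewrite big_split /= mulrC; congr (_ * _).
  by rewrite (bigD1 q) //= eqxx expr1 big1 ?mulr1 // => q' /negbTE->.
by apply: Xgen => // q'; have := cP p c0 q'; case: (_ == _); rewrite ?addn1 ?addn0 // => /leqW.
Qed.

(** From degree k1 on, a form is a combination of the f_q with cofactors of lower degree. Repeating
    this leaves products of the f_q times forms of degree below k1; each round lowers the degree, so
    no exponent exceeds j. *)
Lemma hpart_reduced j r : (j < N)%N -> hpart j r ->
  exists c : {ffun 'I_M -> 'I_N} * I -> K,
    r = \sum_p c p *: (\prod_q f q ^+ p.1 q * b p.2).
Proof.
suff H : (j < N)%N -> hpart j r -> X j r by move=> lt /(H lt)[c [_ ->]]; exists c.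
elim/ltn_ind: j r => j IH r ltj Hr.
have [ltk|lek] := ltnP j k1.
  have [c ->] := bP ltk Hr; apply: subsp_sum => // i _.
  case: (Xsub j) => _ _; apply.
  have -> : b i = gen (fun=> 0%N) i by rewrite /gen big1 ?mul1r.
  exact: Xgen.
have [g [gP ->]] := full lek Hr; apply: subsp_sum => // q _.
have lemj := leq_trans lemk1 lek; have := gP q; rewrite lemj => Hg.
have ltjm : (j - m < j)%N by rewrite ltn_subrL m0 (leq_trans m0 lemj).
have [c [cP ->]] : X j (f q * g q); last by exists c.
have [c [cP cE]] : X (j - m).+1 (f q * g q).
  by apply: Xmul; [apply: leq_ltn_trans ltjm ltj|apply: IH => //; apply: ltn_trans ltjm ltj].
by exists c; split=> // p /cP h q'; apply: leq_trans (h q') ltjm.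
Qed.

End Reduction.

Let hpart_mono (e : 'I_n.+1 -> nat) : hpart (\sum_i e i) (\prod_i T i ^+ e i).
Proof.
apply: (big_rec2 (fun r k => hpart k r)); first by exists 1; rewrite scale1r.
move=> i k r _ Hr; elim: (e i) => [|a IH]; first by rewrite mul1r.
by rewrite exprS -mulrA addSn; apply: hpart_gen.
Qed.

(** Were one degree exhausted, [hpart_reduced] would express (J + 1)^n monomials of degree n J
    through at most N^M [#|I|] products, too few when M < n. *)
Lemma forms_ideal_proper : proper_graded T forms_ideal.
Proof.
move=> k0; apply: contrapT => /forallNP H.
have full j : (maxn m k0 <= j)%N -> forall r, hpart j r -> forms_ideal j r.
  move=> lej; apply: (full_above forms_idealP (k0 := k0)) => [r Hr|].
    by apply: contrapT => nr; apply: (H r).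
  by apply: leq_trans lej; apply: leq_maxr.
have [I [b bP]] := hpart_finite_below (maxn m k0).
(* As N <= (n + 1) (J + 1), the number of products is at most J (J + 1)^M, less than (J + 1)^(M + 1)
   <= (J + 1)^n. *)
pose J := (n.+1 ^ M * #|I|)%N; pose N := (n * J).+1.
(* The first n exponents range freely up to J, and the last variable fills the degree up to n J. *)
pose e (x : {ffun 'I_n -> 'I_J.+1}) (i : 'I_n.+1) : nat :=
  if unlift ord_max i is Some k then x k : nat else (n * J - \sum_k x k)%N.
have eE x : (\sum_i e x i = n * J)%N.
  rewrite (bigD1_ord ord_max) //= /e unlift_none.
  rewrite [X in (_ + X)%N](eq_bigr (fun k => x k : nat)) => [|k _]; last by rewrite liftK.
  rewrite subnK // -[n in (n * J)%N]card_ord -sum_nat_const.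
  by apply: leq_sum => k _; rewrite -ltnS.
have /choice[A AP] : forall x, exists c : {ffun 'I_M -> 'I_N} * I -> K,
    \prod_i T i ^+ e x i = \sum_p c p *: (\prod_q f q ^+ p.1 q * b p.2).
  move=> x; apply: (hpart_reduced (leq_maxl m k0) bP full (ltnSn (n * J))).
  by rewrite -(eE x); apply: hpart_mono.
have Kcl : GRing.divring_closed (predT : {pred K}) by split.
have Kdiv (x : K) : x \in predT -> x != 0 -> x \is a GRing.unit by rewrite unitfE.
have [//||a [_ [x0 ax0] aA]] := left_kernel Kcl Kdiv (A := A).
  rewrite card_prod !card_ffun !card_ord.
  have h1 : (N <= n.+1 * J.+1)%N by rewrite /N; nia.
  apply: (@leq_ltn_trans ((n.+1 * J.+1) ^ M * #|I|)); first by rewrite leq_mul2r; case: (M) => [|M']; rewrite ?expn0 ?leqnn ?orbT // leq_exp2r ?h1 ?orbT.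
  rewrite expnMn mulnAC -/J; apply: (@leq_trans (J.+1 * J.+1 ^ M)).
    by rewrite ltn_mul2r expn_gt0 ltnSn.
  by rewrite -expnS leq_pexp2l.
case/eqP: ax0; apply: (indep (e := e) (c := a)) => [x y exy|].
  apply/ffunP => k; apply: val_inj; have := exy (lift ord_max k).
  by rewrite /e liftK.
under eq_bigr => x _ do rewrite AP scaler_sumr.
rewrite exchange_big big1 // => p _ /=.
under eq_bigr => x _ do rewrite scalerA.
by rewrite -scaler_suml aA scale0r.
Qed.

End ProperIdeals.

Import -(notations) mpoly.

Lemma polynomial_algebra (K : fieldType) n : exists (R : comAlgType K) (T : 'I_n -> R),
  forall (E : finType) (e : E -> 'I_n -> nat) (c : E -> K),
  (forall x y, e x =1 e y -> x = y) ->
  \sum_x c x *: \prod_i T i ^+ e x i = 0 -> forall x, c x = 0.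
Proof.
exists (mpoly n K : comAlgType K), (fun i => mpolyX K (mnm1 i)) => E e c inj s0 x0.
pose m x : multinom n := Multinom [tuple e x i | i < n].
have mE x i : m x i = e x i by rewrite mnmE.
have : mcoeff (m x0) (\sum_x c x *: mpolyX K (m x)) = 0.
  suff -> : \sum_x c x *: mpolyX K (m x) = 0 by rewrite mcoeff0.
  rewrite -[RHS]s0; apply: eq_bigr => x _; congr (_ *: _); rewrite mpolyXE_id.
  by apply: eq_bigr => i _; rewrite mE.
rewrite raddf_sum /= (bigD1 x0) //= mcoeffZ mcoeffX eqxx mulr1 big1 ?addr0 // => x ne.
rewrite mcoeffZ mcoeffX; case: eqP => [mm|]; last by rewrite mulr0.
by case/eqP: ne; apply: inj => i; rewrite -!mE mm.
Qed.

Lemma forms_common_zero (K : closedFieldType) n M m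
    (a : 'I_M -> {ffun 'I_m -> 'I_n} -> K) :
  (0 < m)%N -> (M.+1 < n)%N ->
  exists z : 'I_n -> K, (exists i, z i != 0) /\
    forall q, \sum_w a q w * \prod_i z (w i) = 0.
Proof.
case: n a => // n a m0 ltM; have [R [T indep]] := polynomial_algebra K n.+1.
pose f q : R := \sum_w a q w *: \prod_i T (w i).
have gJ := forms_idealP T m f.
have pJ := forms_ideal_proper indep f m0 ltM.
have [J' [gJ' pJ' sJ' JJ']] := saturate gJ pJ.
have [z [z0 zP]] := projective_point gJ' pJ' sJ'.
exists z; split=> // q; apply: zP; apply: JJ'.
exists (fun q' => if q' == q then 1 else 0); split=> [q'|].
  rewrite leqnn subnn; case: eqP => _; last by case: (hpart_subsp T 0).
  by exists 1; rewrite scale1r.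
by rewrite (bigD1 q) //= eqxx mulr1 [X in _ + X]big1 ?addr0 // => q' /negbTE->; rewrite mulr0.
Qed.

(** In coordinates with respect to [om], a form with values in [Q] becomes [M] forms over K. *)
Lemma form_zero (K : closedFieldType) (Q : unitAlgType K) (I : finType) m M
    (y : {ffun 'I_m -> I} -> Q) (om : 'I_M -> Q) :
  (0 < m)%N -> (M.+1 < #|I|)%N -> (forall w, spn (@kscal K Q) om (y w)) ->
  exists z : I -> K, (exists i, z i != 0) /\ \sum_(w : {ffun 'I_m -> I}) (\prod_i z (w i)) *: y w = 0.
Proof.
move=> m0 ltM yS.
have /choice[a aP] : forall w, exists a : 'I_M -> K, y w = \sum_q a q *: om q.
  move=> w; have [c [/kscal_choice[k kE] ->]] := yS w.
  by exists k; apply: eq_bigr => q _; rewrite kE mulr_algl.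
pose h (w : {ffun 'I_m -> 'I_#|I|}) : {ffun 'I_m -> I} := [ffun i => enum_val (w i)].
have [z [[i zi] zP]] := forms_common_zero (fun q w => a (h w) q) m0 ltM.
exists (fun i => z (enum_rank i)); split; first by exists (enum_val i); rewrite enum_valK.
rewrite (reindex h) /=; last first.
  exists (fun w => [ffun i => enum_rank (w i)]) => w _; apply/ffunP => j; rewrite !ffunE.
    by rewrite enum_valK.
  by rewrite enum_rankK.
under eq_bigr => w _ do rewrite aP scaler_sumr.
rewrite exchange_big big1 // => q _; under eq_bigr => w _ do rewrite scalerA.
rewrite -scaler_suml [X in X *: _](_ : _ = 0) ?scale0r //.
rewrite -[RHS](zP q); apply: eq_bigr => w _; rewrite mulrC; congr (_ * _).
by apply: eq_bigr => j _; rewrite ffunE enum_valK.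
Qed.

(** * Tsen's theorem *)

Section SubfieldType.
Variables (R : unitRingType) (L : {pred R}).
Hypotheses (Rdiv : forall x : R, x != 0 -> x \is a GRing.unit)
  (Lcl : GRing.divring_closed L) (Lcomm : forall x y, x \in L -> y \in L -> x * y = y * x).

HB.instance Definition _ := GRing.isDivringClosed.Build R L Lcl.

Definition subfield_type := {x : R | x \in L}.
Local Notation sT := subfield_type.
HB.instance Definition _ := [isSub of sT for @sval R (fun x => x \in L)].
HB.instance Definition _ := [Choice of sT by <:].
HB.instance Definition _ := [SubChoice_isSubUnitRing of sT by <:].

Let sT_mulC (x y : sT) : x * y = y * x.
Proof. by apply: val_inj; rewrite !rmorphM /= Lcomm // ; apply: valP. Qed.
HB.instance Definition _ := GRing.PzRing_hasCommutativeMul.Build sT sT_mulC.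

Let sT_field : GRing.field_axiom sT.
Proof.
move=> x x0; rewrite unitrE; apply/eqP; apply: val_inj.
by rewrite rmorphM /= divrr // Rdiv //; apply: contraNneq x0 => e; apply/eqP/val_inj.
Qed.
HB.instance Definition _ := GRing.ComUnitRing_isField.Build sT sT_field.

(** Makes determinants and minimal polynomials of matrices over [L] available. *)
Lemma subfield_as_type : exists (F : fieldType) (f : {rmorphism F -> R}),
  forall q, q \in L <-> exists y, q = f y.
Proof.
exists (sT : fieldType), (val : {rmorphism sT -> R}) => q; split=> [Lq|[y ->]].
  by exists (Sub q Lq); rewrite /= ?SubK.
exact: valP.
Qed.

End SubfieldType.

(** * Determinants of right multiplication on a division algebra *)

Section RightMultiplicationMatrix.
Variables (K : fieldType) (Q : unitAlgType K).
Hypothesis Qdiv : forall x : Q, x != 0 -> x \is a GRing.unit.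
Variables (D L : {pred Q}) (F : fieldType) (f : {rmorphism F -> Q}) (m : nat) (eps : 'I_m.+1 -> Q).
Hypotheses (Dcl : divalg_closed D) (Lcl : divalg_closed L).
Hypotheses (LD : forall x, x \in L -> x \in D) (CL : forall x, x \in centz D D -> x \in L).
Hypothesis fL : forall q, q \in L <-> exists y, q = f y.
Hypotheses (epsD : forall i, eps i \in D) (feps : frl L eps)
  (seps : forall x, x \in D -> spn L eps x).

Definition rmul_mx (d : Q) (A : 'M[F]_m.+1) : Prop :=
  forall i, eps i * d = \sum_j f (A i j) * eps j.

Let fL' y : f y \in L. Proof. by apply/fL; exists y. Qed.

Lemma rmul_mx_ex d : d \in D -> exists A, rmul_mx d A.
Proof.
move=> Dd; have /choice[c cP] : forall i, spn L eps (eps i * d).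
  by move=> i; apply: seps; rewrite (divringM Dcl).
have /choice[B BP] : forall p : 'I_m.+1 * 'I_m.+1, exists y, c p.1 p.2 = f y.
  by move=> p; apply/fL; case: (cP p.1).
exists (\matrix_(i, j) B (i, j)) => i; rewrite (cP i).2.
by apply: eq_bigr => j _; rewrite mxE -(BP (i, j)).
Qed.

Lemma coord_inj (a b : 'I_m.+1 -> F) :
  \sum_j f (a j) * eps j = \sum_j f (b j) * eps j -> a =1 b.
Proof.
move=> ab j; apply/eqP; rewrite -subr_eq0; apply/eqP/(fmorph_inj f).
rewrite rmorph0; apply: (feps (c := fun j => f (a j - b j))) => [i|]; first exact: fL'.
under eq_bigr => i _ do rewrite rmorphB mulrBl.
by rewrite sumrB ab subrr.
Qed.

Lemma rmul_mx1 : rmul_mx 1 1%:M.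
Proof.
move=> i; rewrite mulr1 (bigD1 i) //= mxE eqxx rmorph1 mul1r big1 ?addr0 // => j ne.
by rewrite mxE eq_sym (negbTE ne) rmorph0 mul0r.
Qed.

Lemma rmul_mxM d A e B : rmul_mx d A -> rmul_mx e B -> rmul_mx (d * e) (A *m B).
Proof.
move=> dA eB i; rewrite mulrA dA mulr_suml.
under eq_bigr => j _.
  rewrite -mulrA eB mulr_sumr; under eq_bigr => k _ do rewrite mulrA -rmorphM; over.
rewrite exchange_big /=; apply: eq_bigr => k _.
by rewrite mxE rmorph_sum mulr_suml.
Qed.

Lemma rmul_mxX d A k : rmul_mx d A -> rmul_mx (d ^+ k) (A ^+ k).
Proof.
move=> dA; elim: k => [|k IH]; first exact: rmul_mx1.
by rewrite !exprS; apply: rmul_mxM.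
Qed.

(** The coefficients have to pass to the left of the [eps i], hence are taken in the centre. *)
Lemma rmul_mx_sum (I : finType) (c : I -> F) (y : I -> Q) (B : I -> 'M_m.+1) :
  (forall a, f (c a) \in centz D D) -> (forall a, rmul_mx (y a) (B a)) ->
  rmul_mx (\sum_a f (c a) * y a) (\sum_a c a *: B a).
Proof.
move=> cC yB i; rewrite mulr_sumr.
under eq_bigr => a _.
  have /centzP[_ ca] := cC a.
  rewrite mulrA -ca // -mulrA yB mulr_sumr.
  under eq_bigr => j _ do rewrite mulrA -rmorphM; over.
rewrite exchange_big /=; apply: eq_bigr => j _.
rewrite summxE rmorph_sum mulr_suml; apply: eq_bigr => a _.
by rewrite mxE.
Qed.

Lemma rmul_mx_horner d A (p : {poly F}) i : rmul_mx d A ->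
  \sum_(k < size p) f p`_k * (eps i * d ^+ k) = \sum_j f (horner_mx A p i j) * eps j.
Proof.
move=> dA; have -> : horner_mx A p = \sum_(k < size p) p`_k *: A ^+ k.
  rewrite -{1}[p]coefK poly_def rmorph_sum /=.
  by apply: eq_bigr => k _; rewrite linearZ /= rmorphXn /= horner_mx_X.
under eq_bigr => k _.
  rewrite (rmul_mxX k dA) mulr_sumr; under eq_bigr => j _ do rewrite mulrA -rmorphM; over.
rewrite exchange_big /=; apply: eq_bigr => j _.
rewrite summxE rmorph_sum mulr_suml; apply: eq_bigr => k _.
by rewrite mxE.
Qed.

Lemma rmul_mx_singular d A : rmul_mx d A -> \det A = 0 -> d = 0.
Proof.
move=> dA /eqP/det0P[v v0 vA].
have : (\sum_i f (v 0 i) * eps i) * d = 0.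
  rewrite mulr_suml; under eq_bigr => i _.
    rewrite -mulrA dA mulr_sumr; under eq_bigr => j _ do rewrite mulrA -rmorphM; over.
  rewrite exchange_big big1 // => j _; rewrite -mulr_suml -rmorph_sum /=.
  by move/rowP: vA => /(_ j); rewrite !mxE => ->; rewrite rmorph0 mul0r.
case/(divr_eq0 Qdiv) => // e0; case/eqP: v0; apply/rowP => i; rewrite mxE.
apply: (coord_inj (a := fun i => v 0 i) (b := fun=> 0)).
by rewrite e0 big1 // => j _; rewrite rmorph0 mul0r.
Qed.

(* When the powers of [d] up to the dimension are free over the centre, the
   characteristic polynomial of right multiplication by [d] is its minimal polynomial,
   hence has coefficients in the centre. *)
Lemma det_central d A : d \in D -> rmul_mx d A ->
  frl (centz D D) (fun j : 'I_m.+1 => d ^+ j) ->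
  spn (centz D D) (fun j : 'I_m.+1 => d ^+ j) (d ^+ m.+1) ->
  f (\det A) \in centz D D.
Proof.
move=> Dd dA fd [c [cC de]]; have Ccl := centz_divalg D Dcl.
have fin_comm y x : f y \in centz D D -> x \in D -> f y * x = x * f y.
  by move=> /centzP[_ cy] Dx; apply: cy.
have /choice[c' c'E] : forall j, exists y, c j = f y by move=> j; apply/fL/CL.
pose p : {poly F} := 'X^(m.+1) - \poly_(j < m.+1) (if insub j is Some j' then c' j' else 0).
have sp1 : (size (\poly_(j < m.+1) (if insub j is Some j' then c' j' else 0%R)) < m.+2)%N.
  by rewrite ltnS size_poly.
have sp : size p = m.+2 by rewrite size_polyDl size_polyXn // size_polyN.
have pmon : p \is monic.
  by rewrite monicE lead_coefDl ?lead_coefXn // size_polyN size_polyXn.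
have pk (k : 'I_m.+1) : p`_k = - c' k.
  by rewrite coefB coefXn coef_poly ltn_ord valK eqn_leq [(_ <= k)%N]leqNgt ltn_ord andbF sub0r.
have pm : p`_m.+1 = 1 by rewrite -(monicP pmon) lead_coefE sp.
have hp : horner_mx A p = 0.
  apply/matrixP => i j; rewrite mxE.
  apply: (coord_inj (a := fun j => horner_mx A p i j) (b := fun=> 0)).
  rewrite -(rmul_mx_horner p i dA) sp big_ord_recr /= pm rmorph1 mul1r de.
  rewrite [RHS]big1 => [|k _]; last by rewrite rmorph0 mul0r.
  rewrite mulr_sumr -big_split big1 //= => k _.
  rewrite pk rmorphN mulNr -c'E !mulrA.
  by have /centzP[_ ck] := cC k; rewrite ck // addNr.
have q_dvd_p := mxminpoly_min hp.
(* A shorter minimal polynomial, with coefficients q_k in [L], would give sum_k q_k x d^k = 0 for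
   all x in [D], against [two_sided_free]. *)
have sq : (m.+1 < size (mxminpoly A))%N.
  rewrite ltnNge; apply/negP => sq.
  have q0 : mxminpoly A != 0 by apply/monic_neq0/mxminpoly_monic.
  suff q00 : forall k : 'I_m.+1, f (mxminpoly A)`_k = 0.
    case/eqP: q0; apply/polyP => k; rewrite coef0.
    have [ltk|lek] := ltnP k m.+1; last by rewrite nth_default // (leq_trans sq lek).
    by apply: (fmorph_inj f); rewrite rmorph0; apply: (q00 (Ordinal ltk)).
  apply: (two_sided_free Qdiv (D := D) (q := fun j : 'I_m.+1 => d ^+ j)
    (l := fun j : 'I_m.+1 => f (mxminpoly A)`_j)) => // [j|j|x Dx].
  - exact: divalgX.
  - exact/LD/fL'.
  have he i : \sum_(k < m.+1) f (mxminpoly A)`_k * (eps i * d ^+ k) = 0.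
    have := rmul_mx_horner (mxminpoly A) i dA; rewrite mx_root_minpoly.
    rewrite [RHS]big1 => [e0|j _]; last by rewrite mxE rmorph0 mul0r.
    rewrite -[RHS]e0 (big_ord_widen _ (fun k => f (mxminpoly A)`_k * (eps i * d ^+ k)) sq).
    rewrite [RHS]big_mkcond /=; apply: eq_bigr => k _; case: ltnP => // le.
    by rewrite nth_default // rmorph0 mul0r.
  have [b [bL ->]] := seps Dx.
  have fC a y e g : f a * (f y * e) * g = f y * (f a * (e * g)).
    by rewrite !mulrA -!rmorphM (mulrC a).
  under eq_bigr => k _.
    rewrite mulr_sumr mulr_suml.
    under eq_bigr => i _ do (have /fL[y yE] := bL i; rewrite yE fC -yE); over.
  rewrite exchange_big big1 // => i _.
  by rewrite -mulr_sumr he mulr0.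
have mon_eq (g h : {poly F}) : g \is monic -> h \is monic -> g %| h -> (size h <= size g)%N -> g = h.
  move=> gm hm gh le; apply/eqP; rewrite -eqp_monic //.
  by rewrite -dvdp_size_eqp // eqn_leq dvdp_leq ?monic_neq0.
have pq : mxminpoly A = p by apply: mon_eq; rewrite ?mxminpoly_monic ?sp.
have pc : p = char_poly A.
  apply: mon_eq; rewrite ?char_poly_monic ?size_char_poly ?sp //.
  by rewrite -pq mxminpoly_dvd_char.
have := char_poly_det A; rewrite -pc => /(congr1 (fun y => (-1) ^+ m.+1 * y)).
rewrite mulrA -exprMn mulrNN mulr1 expr1n mul1r => <-.
rewrite rmorphM rmorphXn rmorphN1 -[0%N]/(nat_of_ord (ord0 : 'I_m.+1)) pk rmorphN -c'E.
apply: (divringM Ccl); last exact: (divringN Ccl).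
by apply: divalgX => //; apply: (divringN Ccl); apply: (divring1 Ccl).
Qed.

Lemma det_central_scalar d A : d \in centz D D -> rmul_mx d A -> f (\det A) \in centz D D.
Proof.
move=> Cd dA; have Ccl := centz_divalg D Dcl.
have /fL[y dE] := CL Cd.
have -> : A = y%:M.
  apply/matrixP => i j; rewrite mxE.
  apply: (coord_inj (a := fun j => A i j) (b := fun j => y *+ (i == j))).
  rewrite -dA (bigD1 i) //= eqxx mulr1n -dE big1 ?addr0 => [|j' ne].
    by have /centzP[_ ->] := Cd.
  by rewrite eq_sym (negbTE ne) mulr0n rmorph0 mul0r.
by rewrite det_scalar rmorphXn -dE; apply: divalgX.
Qed.

End RightMultiplicationMatrix.

(** Multilinearity in the rows exhibits the determinant as a form in the [c a], indexed by words to
    match [form_zero]. *)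
Lemma det_sum_scale (R : comNzRingType) (m : nat) (I : finType) (c : I -> R)
    (B : I -> 'M[R]_m) :
  \det (\sum_a c a *: B a) = \sum_(w : {ffun 'I_m -> I})
    (\prod_v c (w v)) * \sum_(s : 'S_m) (-1) ^+ s * \prod_v B (w v) v (s v).
Proof.
rewrite /determinant; under eq_bigr => s _.
  under eq_bigr => v _ do rewrite summxE.
  rewrite bigA_distr_bigA /= mulr_sumr; over.
rewrite exchange_big /=; apply: eq_bigr => w _; rewrite mulr_sumr; apply: eq_bigr => s _.
rewrite mulrCA; congr (_ * _); rewrite -big_split; apply: eq_bigr => v _.
by rewrite mxE.
Qed.

(** * Degrees over the centre *)

Section Degrees.
Variables (K : fieldType) (Q : unitAlgType K).
Hypothesis Qdiv : forall x : Q, x != 0 -> x \is a GRing.unit.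

Lemma spn_scalars (S S' : {pred Q}) (I : finType) (w : I -> Q) x :
  (forall c, c \in S -> c \in S') -> spn S w x -> spn S' w x.
Proof. by move=> SS' [c [cS ->]]; exists c; split=> // i; apply/SS'/cS. Qed.

Lemma fdim_sub (S : {pred Q}) (X Y : Q -> Prop) n :
  GRing.divring_closed S -> (forall x, Y x -> X x) -> fdim S X n ->
  exists2 k, (k <= n)%N & fdim S Y k.
Proof.
move=> Scl YX dX; apply: fdim_bounded => // k v Yv fv.
by rewrite -[k]card_ord; apply: (fdim_le Qdiv Scl dX _ fv) => i; apply/YX.
Qed.

Lemma divalg_lspace (S D : {pred Q}) : divalg_closed D -> (forall c, c \in S -> c \in D) ->
  lspace S (fun x => x \in D).
Proof.
move=> Dcl SD; split; first exact: (divring0 Dcl).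
  by move=> x y; apply: (divringD Dcl).
by move=> c x /SD; apply: (divringM Dcl).
Qed.

Lemma fdim_gt0 (S D : {pred Q}) n : divalg_closed D -> fdim S (fun x => x \in D) n -> (0 < n)%N.
Proof.
move=> Dcl [v [_ _ vs]]; case: n v vs => // v /(_ 1 (divring1 Dcl))[c [_ /eqP]].
by rewrite big_ord0 oner_eq0.
Qed.

(** Let C be the centre, M the centralizer of [d], l = [M : C], mu = [D : M], and e the degree of
    [d] over C. Then r = l mu; e <= l, as M contains the powers of [d]; mu <= e by
    [centralizer_codim_le]; and r <= mu^2 by [centre_fdim], M being commutative. So l <= mu <= e <=
    l. *)
Lemma noncentral_degree (D : {pred Q}) d r :
  divalg_closed D -> d \in D -> fdim (centz D D) (fun x => x \in D) r ->
  commutative_set (centz D (pred1 d)) ->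
  exists e, [/\ (e * e)%N = r, fdim (centz D (pred1 d)) (fun x => x \in D) e,
    frl (centz D D) (fun j : 'I_e => d ^+ j)
    & spn (centz D D) (fun j : 'I_e => d ^+ j) (d ^+ e)].
Proof.
move=> Dcl Dd dr Mcomm.
set C := centz D D; set M := centz D (pred1 d).
have Ccl : divalg_closed C by apply: centz_divalg.
have Mcl : divalg_closed M by apply: centz_divalg.
have MD x : x \in M -> x \in D by case/centzP.
have CM x : x \in C -> x \in M.
  by move=> /centzP[Dx cx]; apply/centzP; split=> // y /eqP->; apply: cx.
have dM : d \in M by apply/centzP; split=> // y /eqP->.
have [l _ dl] := fdim_sub Ccl MD dr.
have [u [_ _ us]] := dr.
have [mu _ dmu] := fdim_spanned Qdiv Mcl (fun x Dx => spn_scalars CM (us x Dx)).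
have rE : r = (l * mu)%N.
  apply: (fdim_uniq Qdiv Ccl dr); apply: (fdim_tower Ccl Mcl CM _ dl dmu).
  exact: divalg_lspace.
have [r' ler' dr'] := centre_fdim Qdiv Dcl Mcl MD Mcomm dmu.
rewrite (fdim_uniq Qdiv Ccl dr' dr) in ler'.
have exe : exists e, `[< spn C (fun j : 'I_e => d ^+ j) (d ^+ e) >].
  apply: contrapT => /forallNP H.
  have fr : frl C (fun j : 'I_l.+1 => d ^+ j).
    apply: (frl_extend_all Qdiv Ccl (v := fun j => d ^+ j)) => i _ si.
    by apply: (H i); apply/asboolP.
  suff : (l.+1 <= l)%N by rewrite ltnn.
  rewrite -[X in (X <= _)%N](card_ord l.+1).
  by apply: (fdim_le Qdiv Ccl dl _ fr) => i; apply: divalgX.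
case: (ex_minnP exe) => e /asboolP se mine.
have fe : frl C (fun j : 'I_e => d ^+ j).
  apply: (frl_extend_all Qdiv Ccl (v := fun j => d ^+ j)) => i lti /asboolP/mine.
  by rewrite leqNgt lti.
have el : (e <= l)%N.
  by rewrite -[e]card_ord; apply: (fdim_le Qdiv Ccl dl _ fe) => i; apply: divalgX.
have mue : (mu <= e)%N.
  by have [v [vD fv _]] := dmu; apply: (centralizer_codim_le Qdiv Dcl Dd vD fv se).
have mu0 := fdim_gt0 Dcl dmu.
have le : (l <= mu)%N by rewrite rE leq_pmul2r in ler'.
have muE : mu = e by apply/eqP; rewrite eqn_leq mue (leq_trans el).
have lE : l = e by apply/eqP; rewrite eqn_leq el andbT (leq_trans le).
by exists e; split; rewrite // ?rE ?muE ?lE // -muE.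
Qed.

(** A coordinate in a basis of [L] over [C], divided by its nonzero value at 1. The norm form has
    coefficients in [L] but values in [C]; retracting the coefficients leaves the values unchanged
    and puts the form over [C]. *)
Lemma retraction (C L : {pred Q}) l :
  divalg_closed C -> divalg_closed L -> (forall x, x \in C -> x \in L) ->
  fdim C (fun x => x \in L) l ->
  exists pi : Q -> Q, [/\ forall x, x \in L -> pi x \in C, forall x, x \in C -> pi x = x
    & forall (I : finType) (c x : I -> Q), (forall i, c i \in C) -> (forall i, x i \in L) ->
        pi (\sum_i c i * x i) = \sum_i c i * pi (x i)].
Proof.
move=> Ccl Lcl CL [v [vL fv vs]].
have /choice[co coP] : forall x, exists c : 'I_l -> Q, x \in L ->
    (forall i, c i \in C) /\ x = \sum_i c i * v i.
  move=> x; have [Lx|nLx] := boolP (x \in L); last by exists (fun=> 0).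
  by have [c cP] := vs x Lx; exists c.
have co_uniq x c i : x \in L -> (forall i, c i \in C) -> x = \sum_i c i * v i -> co x i = c i.
  move=> Lx cC xE; apply/eqP; rewrite -subr_eq0; apply/eqP.
  have [coC coE] := coP x Lx.
  apply: (fv (fun i => co x i - c i)) => [j|].
    by rewrite (divringD Ccl) ?(divringN Ccl).
  under eq_bigr => j _ do rewrite mulrBl.
  by rewrite sumrB -coE -xE subrr.
have L1 : 1 \in L by apply: (divring1 Lcl).
have [i0 co10] : exists i, co 1 i != 0.
  apply: contrapT => /forallNP H; have [_ /eqP] := coP 1 L1.
  rewrite big1 ?oner_eq0 // => i _.
  by have /negP/negPn/eqP-> := H i; rewrite mul0r.
have colin (I : finType) (c x : I -> Q) : (forall i, c i \in C) -> (forall i, x i \in L) ->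
    co (\sum_i c i * x i) i0 = \sum_i c i * co (x i) i0.
  move=> cC xL; apply: (co_uniq _ (fun j => \sum_i c i * co (x i) j)).
  - by apply: (divring_sum Lcl) => i _; apply: (divringM Lcl) => //; apply: CL.
  - by move=> j; apply: (divring_sum Ccl) => i _; rewrite (divringM Ccl) //; case: (coP (x i) (xL i)).
  under [RHS]eq_bigr => j _ do rewrite mulr_suml.
  rewrite exchange_big; apply: eq_bigr => i _ /=.
  rewrite {1}(coP (x i) (xL i)).2 mulr_sumr; apply: eq_bigr => j _.
  by rewrite mulrA.
exists (fun x => co x i0 * (co 1 i0)^-1); split.
- move=> x Lx; rewrite (divringM Ccl) ?(divringV Ccl) //; first by case: (coP x Lx).
  by case: (coP 1 L1).
- move=> x Cx; have := colin 'I_1 (fun=> x) (fun=> 1) (fun=> Cx) (fun=> L1).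
  by rewrite !big_ord1 mulr1 => ->; rewrite mulrK // Qdiv.
move=> I c x cC xL; rewrite colin // mulr_suml; apply: eq_bigr => i _.
by rewrite mulrA.
Qed.

End Degrees.

Section NormForm.
Variables (K : closedFieldType) (Q : unitAlgType K).
Hypothesis Qdiv : forall x : Q, x != 0 -> x \is a GRing.unit.

Lemma spn_horner_powers (t : Q) (s B : nat) (h : 'I_s -> Q) (r : 'I_s -> {poly K}) :
  (forall q, size (r q) <= B)%N ->
  spn (@kscal K Q) (fun p : 'I_s * 'I_B => t ^+ p.2 * h p.1) (\sum_q horner_alg t (r q) * h q).
Proof.
move=> sr; exists (fun p : 'I_s * 'I_B => ((r p.1)`_p.2)%:A); split=> [p|].
  by apply/kscalP; exists (r p.1)`_p.2.
rewrite sum_pairE; apply: eq_bigr => q _; rewrite (@horner_algE _ _ t (r q) B) // mulr_suml.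
by apply: eq_bigr => j _; rewrite /= mulr_algl -scalerAl.
Qed.

(* The determinant of right multiplication on [D], over the maximal subfield [L], is a form
   with values in the centre; on combinations of [t ^ j g_i], [j < N], it has about
   [s m N] coordinates in [s m^2 N] unknowns. *)
Lemma norm_form_isotropic (t a0 : Q) (D : {pred Q}) k :
  transc t -> divalg_closed D -> t \in centz D D ->
  fdim (adjoin t) (fun x => x \in D) k ->
  a0 \in D -> a0 \notin centz D D ->
  (forall d, d \in D -> d \notin centz D D -> commutative_set (centz D (pred1 d))) ->
  False.
Proof.
move=> tt Dcl Ct dk Da0 nCa0 Mcomm.
set C := centz D D in Ct nCa0 Mcomm; set F := adjoin t in dk.
have Ccl : divalg_closed C by apply: centz_divalg.
have Fcl : divalg_closed F by apply: adjoin_divalg.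
have CD x : x \in C -> x \in D by case/centzP.
have FC x : x \in F -> x \in C by apply: adjoin_sub.
have [gg [_ _ ggs]] := dk.
have [r _ dr] := fdim_spanned Qdiv Ccl (fun x Dx => spn_scalars FC (ggs x Dx)).
have [s _ ds] := fdim_sub Qdiv Fcl CD dk.
have s0 := fdim_gt0 Ccl ds.
have kE : k = (s * r)%N.
  apply: (fdim_uniq Qdiv Fcl dk); apply: (fdim_tower Fcl Ccl FC _ ds dr).
  exact: divalg_lspace.
have [m0 [m0r dL fa0 sa0]] := noncentral_degree Qdiv Dcl Da0 dr (Mcomm a0 Da0 nCa0).
(* The degree of a noncentral element has square [r], so it is the same [m0] for all of them, which
   is also the dimension of [D] over [L]. *)
have deg d : d \in D -> d \notin C ->
    frl C (fun j : 'I_m0 => d ^+ j) /\ spn C (fun j : 'I_m0 => d ^+ j) (d ^+ m0).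
  move=> Dd nCd; have [e [er _ fe se]] := noncentral_degree Qdiv Dcl Dd dr (Mcomm d Dd nCd).
  suff -> : m0 = e by [].
  by apply/eqP; rewrite -(eqn_sqr m0 e) !expnS !expn0 !muln1 m0r er.
set L := centz D (pred1 a0) in dL.
have Lcl : divalg_closed L by apply: centz_divalg.
have LD x : x \in L -> x \in D by case/centzP.
have CL x : x \in C -> x \in L.
  by move=> /centzP[Dx cx]; apply/centzP; split=> // y /eqP->; apply: cx.
have Lcomm : commutative_set L by apply: Mcomm.
have [FL [f fL]] := subfield_as_type Qdiv Lcl Lcomm.
have fL' y : f y \in L by apply/fL; exists y.
have m1 : (1 < m0)%N.
  rewrite ltnNge; apply/negP => lem; case/negP: nCa0.
  case: m0 lem {m0r dL fa0 deg} sa0 => [|[|//]] _ [c [cC]].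
    by rewrite big_ord0 expr0 => /eqP; rewrite oner_eq0.
  by rewrite big_ord1 expr0 expr1 mulr1 => ->.
case: m0 m1 m0r dL deg {fa0 sa0} => // m m1 mr [eps [epsD feps seps]] deg.
have det_in d A : d \in D -> rmul_mx f eps d A -> f (\det A) \in C.
  move=> Dd dA; have [Cd|nCd] := boolP (d \in C).
    exact: (det_central_scalar Dcl CL fL epsD feps Cd dA).
  have [fd sd] := deg d Dd nCd.
  exact: (det_central Qdiv Dcl LD CL fL epsD feps seps Dd dA fd sd).
have [g [gD fg _]] := dk.
have [h [hC fh hs]] := ds.
have /choice[A AP] : forall i, exists A, rmul_mx f eps (g i) A.
  by move=> i; apply: (rmul_mx_ex Dcl fL epsD seps).
have /fL[tau tauE] : t \in L by apply: CL.
have /choice[kap kapE] : forall c : K, exists y, c%:A = f y.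
  by move=> c; apply/fL/divalgA.
have [l _ dl] := fdim_sub Qdiv Ccl LD dr.
have [pi [piC piK piL]] := retraction Qdiv Ccl Lcl CL dl.
pose gam (i : {ffun 'I_m.+1 -> 'I_k}) : FL :=
  \sum_(sg : 'S_m.+1) (-1) ^+ sg * \prod_v A (i v) v (sg v).
have /choice[c cP] : forall i, exists c : 'I_s -> Q,
    (forall q, c q \in F) /\ pi (f (gam i)) = \sum_q c q * h q.
  by move=> i; apply: hs; apply: piC.
(* Multiplying by [Del] turns the coordinates of the retracted coefficients into polynomials in
   t. *)
have [Del Del0 [rr rrE]] := adjoin_common_den Qdiv tt
  (c := fun p : {ffun 'I_m.+1 -> 'I_k} * 'I_s => c p.1 p.2) (fun p => (cP p.1).1 p.2).
(* The values have s (B + m0 N) coordinates against s m0^2 N unknowns, with m0 = [m.+1] >= 2. The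
   choice of [N] suffices, since m0^2 N - m0 N >= m0 N >= 2 N = 2 B + 4. *)
pose B := (\max_p size (rr p))%N; pose N := (B + 2)%N.
pose I := ('I_k * 'I_N)%type.
pose idx (w : {ffun 'I_m.+1 -> I}) : {ffun 'I_m.+1 -> 'I_k} := [ffun v => (w v).1].
pose dg (w : {ffun 'I_m.+1 -> I}) : nat := (\sum_v (w v).2)%N.
pose y w := t ^+ dg w * (horner_alg t Del * pi (f (gam (idx w)))).
have dgN w : (dg w <= m.+1 * N)%N.
  rewrite -[X in (_ <= X * _)%N](card_ord m.+1) -sum_nat_const; apply: leq_sum => v _.
  exact/ltnW/ltn_ord.
have yS w : spn (@kscal K Q) (fun p : 'I_s * 'I_(B + m.+1 * N) => t ^+ p.2 * h p.1) (y w).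
  have -> : y w = \sum_q horner_alg t ('X^(dg w) * rr (idx w, q)) * h q.
    rewrite /y (cP (idx w)).2 !mulr_sumr; apply: eq_bigr => q _.
    rewrite rmorphM rmorphXn /= horner_algX -!mulrA; congr (_ * _).
    by rewrite (rrE (idx w, q)) /= !mulrA mulrV ?mul1r // Qdiv // transc_neq0.
  apply: spn_horner_powers => q; rewrite mulrC (leq_trans (size_polyMleq _ _)) //.
  rewrite size_polyXn addnS /= leq_add //.
  exact: (leq_bigmax (F := fun p => size (rr p))).
have ltM : (#|{: 'I_s * 'I_(B + m.+1 * N)}|.+1 < #|{: I}|)%N.
  rewrite !card_prod !card_ord kE -mr /N.
  have h1 : (2 * (m.+1 * (B + 2)) <= m.+1 * m.+1 * (B + 2))%N.
    by rewrite -mulnA leq_mul2r m1 orbT.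
  have h2 : (2 * (B + 2) <= m.+1 * (B + 2))%N by rewrite leq_mul2r m1 orbT.
  rewrite -mulnA; move: (m.+1 * m.+1 * (B + 2))%N (m.+1 * (B + 2))%N h1 h2 => u v h1 h2.
  by nia.
have [p [[a pa] pz]] := form_zero (isT : (0 < m.+1)%N) ltM
  (fun w => spn_reindex (enum_val_bijective _) (yS w)).
pose d := \sum_a f (kap (p a) * tau ^+ a.2) * g a.1.
pose AA := \sum_a (kap (p a) * tau ^+ a.2) *: A a.1.
have cfC (a' : I) : f (kap (p a') * tau ^+ a'.2) \in C.
  rewrite rmorphM rmorphXn -kapE -tauE; apply: (divringM Ccl); first exact: divalgA.
  exact: divalgX.
have dA : rmul_mx f eps d AA.
  by apply: (rmul_mx_sum epsD (y := fun a : I => g a.1) (B := fun a : I => A a.1) cfC) => a'; apply: AP.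
have Dd : d \in D.
  apply: (divring_sum Dcl) => a' _; apply: (divringM Dcl) => //; exact/CD/cfC.
have d0 : d != 0.
  apply/eqP => d0; have e0 : \sum_(i < k) (\sum_(j < N) p (i, j) *: t ^+ j) * g i = 0.
    rewrite -[RHS]d0 /d sum_pairE; apply: eq_bigr => i _; rewrite mulr_suml; apply: eq_bigr => j _.
    by rewrite rmorphM rmorphXn /= -kapE -tauE mulr_algl.
  case: a pa => i j /eqP; apply.
  have pF (i' : 'I_k) : \sum_(j < N) p (i', j) *: t ^+ j \in F.
    by apply: (divring_sum Fcl) => j' _; apply: divalgZ => //; apply: divalgX => //; apply: adjoin_gen.
  have pi0 := fg (fun i => \sum_(j < N) p (i, j) *: t ^+ j) pF e0 i.
  have /eqP : (p (i, j))%:A = 0 :> Q.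
    apply: (frl_powers tt (c := fun j : 'I_N => (p (i, j))%:A)) => [j'|].
      by apply/kscalP; exists (p (i, j')).
    by rewrite -[RHS]pi0; apply: eq_bigr => j' _; rewrite mulr_algl.
  by rewrite scaler_eq0 oner_eq0 orbF => /eqP.
case/eqP: d0; apply: (rmul_mx_singular Qdiv fL feps dA).
have detE : f (\det AA) = \sum_(w : {ffun 'I_m.+1 -> I})
    ((\prod_v p (w v))%:A * t ^+ dg w) * f (gam (idx w)).
  rewrite det_sum_scale rmorph_sum; apply: eq_bigr => w _ /=; rewrite rmorphM; congr (_ * f _).
    rewrite big_split /= rmorphM; congr (_ * _); last first.
      by rewrite prodrXr rmorphXn -tauE.
    rewrite rmorph_prod; apply: etrans (_ : \prod_v (p (w v))%:A = _); last first.
      exact/esym/(rmorph_prod (in_alg Q)).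
    by apply: eq_bigr => v _; rewrite -kapE.
  by apply: eq_bigr => sg _; congr (_ * _); apply: eq_bigr => v _; rewrite ffunE.
have : f (\det AA) = 0.
  rewrite -(piK _ (det_in d AA Dd dA)) detE piL // => [|w]; last first.
    apply: (divringM Ccl); [exact: divalgA|exact: divalgX].
  have : horner_alg t Del * \sum_(w : {ffun 'I_m.+1 -> I})
      ((\prod_v p (w v))%:A * t ^+ dg w) * pi (f (gam (idx w))) = 0.
    rewrite -[RHS]pz mulr_sumr; apply: eq_bigr => w _; rewrite /y mulr_algl -!scalerAl -scalerAr.
    congr (_ *: _); rewrite mulrA; have -> : horner_alg t Del * t ^+ dg w = t ^+ dg w * horner_alg t Del.
      by apply: horner_alg_comm; rewrite -exprS -exprSr.
    by rewrite mulrA.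
  by case/(divr_eq0 Qdiv) => // /eqP; rewrite (negbTE (transc_neq0 tt Del0)).
by move/eqP; rewrite fmorph_eq0 => /eqP.
Qed.

(** By induction on the dimension: in a noncommutative [D], the centralizer of a noncentral element
    is strictly smaller and still has t in its centre, so it is commutative, as
    [norm_form_isotropic] requires. *)
Lemma tsen_commutative (t : Q) n (D : {pred Q}) k :
  transc t -> (k <= n)%N -> divalg_closed D -> t \in centz D D ->
  fdim (adjoin t) (fun x => x \in D) k -> commutative_set D.
Proof.
move=> tt; elim: n D k => [|n IH] D k lekn Dcl Ct dk.
  by have := fdim_gt0 Dcl dk; rewrite lt0n -leqn0 lekn.
have Fcl : divalg_closed (adjoin t) by apply: adjoin_divalg.
have Dt : t \in D by case/centzP: Ct.
apply: contrapT => ncomm.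
have [a0 Da0 nCa0] : exists2 a, a \in D & a \notin centz D D.
  apply: contrapT => H; apply: ncomm => x y Dx Dy.
  have /centzP[_ cx] : x \in centz D D by apply/negPn/negP => nx; apply: H; exists x.
  exact: cx.
apply: (norm_form_isotropic tt Dcl Ct dk Da0 nCa0) => d Dd nCd.
set M := centz D (pred1 d).
have MD x : x \in M -> x \in D by case/centzP.
have [k' lek' dk'] := fdim_sub Qdiv Fcl MD dk.
have ltk' : (k' < k)%N.
  rewrite ltn_neqAle lek' andbT; apply/eqP => kE; rewrite kE in dk'.
  have [v [vM fv _]] := dk'; case/negP: nCd.
  have tM : t \in M.
    by case/centzP: Ct => _ ct; apply/centzP; split=> // y /eqP->; apply: ct.
  have Mcl : divalg_closed M by apply: centz_divalg.
  have DM y : y \in D -> y \in M.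
    move=> Dy; have := fdim_full Qdiv Fcl dk (fun i => MD _ (vM i)) fv Dy.
    apply: (spn_sub (X := fun y => y \in M) _ vM); apply: divalg_lspace => // c.
    exact: adjoin_sub.
  apply/centzP; split=> // y /DM/centzP[_ cy]; by rewrite cy // inE.
apply: (IH M k') dk'; first by rewrite -ltnS (leq_trans ltk').
  exact: centz_divalg.
case/centzP: Ct => _ ct; apply/centzP; split.
  by apply/centzP; split=> // y /eqP->; apply: ct.
by move=> y /MD; apply: ct.
Qed.

End NormForm.

(** * Finiteness over the centre *)

Section Conclusions.
Variables (K : closedFieldType) (Q : unitAlgType K).
Hypothesis Qdiv : forall x : Q, x != 0 -> x \is a GRing.unit.

(** Algebraic dependence is symmetric: the powers of t are dependent over K(a), and since a and t
    commute, the resulting polynomial relation can be read as one for a over K[t]. *)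
Lemma adjoin_algebraic (a t : Q) (D : {pred Q}) n :
  transc a -> transc t -> divalg_closed D -> t \in D -> t * a = a * t ->
  fdim (adjoin a) (fun x => x \in D) n ->
  exists J, spn (adjoin t) (fun j : 'I_J => a ^+ j) (a ^+ J).
Proof.
move=> ta tt Dcl Dt cta dn.
have Ecl : divalg_closed (adjoin a) by apply: adjoin_divalg.
have Fcl : divalg_closed (adjoin t) by apply: adjoin_divalg.
have [p [p0 [i0 pi0]]] : exists p : 'I_n.+1 -> {poly K},
    \sum_i horner_alg a (p i) * t ^+ i = 0 /\ exists i, p i != 0.
  apply: contrapT => /forallNP H.
  suff : (n.+1 <= n)%N by rewrite ltnn.
  rewrite -[X in (X <= _)%N](card_ord n.+1).
  apply: (fdim_le Qdiv Ecl dn (v := fun i : 'I_n.+1 => t ^+ i)) => [i|]; first exact: divalgX.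
  apply: (frl_adjoin Qdiv ta) => p p0 i; apply: contrapT => /eqP pi0.
  by apply: (H p); split=> //; exists i.
apply: contrapT => /forallNP H; pose J := (\max_i size (p i))%N.
have fr : frl (adjoin t) (fun j : 'I_J => a ^+ j).
  by apply: (frl_extend_all Qdiv Fcl (v := fun j => a ^+ j)) => j _; apply: H.
have sJ i : (size (p i) <= J)%N by apply: (leq_bigmax (F := fun i => size (p i))).
pose q (j : 'I_J) : {poly K} := \poly_(i < n.+1) (if insub i is Some i' then (p i')`_j else 0).
have qE (i : 'I_n.+1) j : (q j)`_i = (p i)`_j by rewrite coef_poly ltn_ord valK.
have q0 j : horner_alg t (q j) = 0.
  apply: (fr (fun j => horner_alg t (q j))) => [j'|]; first exact: adjoin_horner.
  rewrite -[RHS]p0; under [RHS]eq_bigr => i _ do rewrite (horner_algE _ (sJ i)) mulr_suml.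
  rewrite exchange_big /=; apply: eq_bigr => j' _.
  rewrite (horner_algE _ (size_poly _ _)) mulr_suml; apply: eq_bigr => i _.
  rewrite qE -!scalerAl; congr (_ *: _).
  by apply: commrX; apply/esym/commrX; apply/esym.
case/eqP: pi0; apply/polyP => j; rewrite coef0.
have [ltj|lej] := ltnP j J; last by rewrite nth_default // (leq_trans (sJ i0) lej).
by rewrite -(qE i0 (Ordinal ltj)) (tt _ (q0 _)) coef0.
Qed.

(** [D] is finite over its centre, which is not K because the powers of a are free over K. A central
    non-scalar t is transcendental, and a is algebraic over K(t); so [D] is finite over the central
    subfield K(t), where [tsen_commutative] applies. *)
Lemma finite_over_adjoin_commutative (a : Q) (D : {pred Q}) n :
  transc a -> divalg_closed D -> a \in D ->
  fdim (adjoin a) (fun x => x \in D) n -> commutative_set D.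
Proof.
move=> ta Dcl Da dn.
have Ecl : divalg_closed (adjoin a) by apply: adjoin_divalg.
have ED x : x \in adjoin a -> x \in D by apply: adjoin_sub.
have Ecomm : commutative_set (adjoin a) by exact: adjoin_commutative.
have [r _ dr] := centre_fdim Qdiv Dcl Ecl ED Ecomm dn.
have [t Ct nKt] : exists2 t, t \in centz D D & t \notin @kscal K Q.
  apply: contrapT => H.
  have CK c : c \in centz D D -> c \in @kscal K Q.
    by move=> Cc; apply/negPn/negP => nK; apply: H; exists c.
  have [u [_ _ us]] := dr; suff : (r.+1 <= r)%N by rewrite ltnn.
  rewrite -[X in (X <= _)%N](card_ord r.+1) -[X in (_ <= X)%N](card_ord r).
  apply: (frl_le_spn Qdiv (kscal_divalg Q) (frl_powers ta)) => i.
  by apply: (spn_scalars CK); apply: us; apply: divalgX.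
have tt : transc t by apply: contrapT => /(transc_notin Qdiv); rewrite (negbTE nKt).
have /centzP[Dt ct] := Ct.
have Fcl : divalg_closed (adjoin t) by apply: adjoin_divalg.
have [J aJ] := adjoin_algebraic ta tt Dcl Dt (ct a Da) dn.
have EB e : e \in adjoin a -> spn (adjoin t) (fun j : 'I_J => a ^+ j) e.
  move=> Ee; have := spn_mul_adjoin Qdiv Fcl ta (oner_neq0 _) (L := J) _ Ee.
  by rewrite !mul1r; under eq_fun do rewrite mul1r; apply.
have [v [_ _ vs]] := dn.
have Fs x : x \in D -> spn (adjoin t) (fun p : 'I_n * 'I_J => a ^+ p.2 * v p.1) x.
  move=> /vs[c [cE ->]].
  have /choice[b bP] : forall i, exists b : 'I_J -> Q,
      (forall j, b j \in adjoin t) /\ c i = \sum_j b j * a ^+ j by move=> i; apply: EB.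
  exists (fun p => b p.1 p.2); split=> [p|]; first by case: (bP p.1).
  rewrite sum_pairE; apply: eq_bigr => i _; rewrite {1}(bP i).2 mulr_suml.
  by apply: eq_bigr => j _; rewrite mulrA.
have [k _ dk] := fdim_spanned Qdiv Fcl Fs.
exact: (tsen_commutative Qdiv tt (leqnn k) Dcl Ct dk).
Qed.

Lemma alg_indep2_transc (x y : Q) : alg_indep2 x y -> transc x.
Proof.
move=> ind p p0; apply/polyP => i; rewrite coef0.
have [lti|lei] := ltnP i (size p); last by rewrite nth_default.
have := ind (size p) (fun i j => if j == 0%N :> nat then p`_i else 0) _ (Ordinal lti) (Ordinal (leq_ltn_trans (leq0n i) lti)).
apply; rewrite -[RHS]p0 (horner_algE _ (leqnn _)); apply: eq_bigr => k _.
rewrite (bigD1 (Ordinal (leq_ltn_trans (leq0n i) lti))) //= expr0 mulr1 big1 ?addr0 // => j.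
by rewrite -val_eqE /= => /negbTE->; rewrite scale0r.
Qed.

Lemma alg_indep2_free (x y : Q) r : alg_indep2 x y -> frl (adjoin x) (fun i : 'I_r => y ^+ i).
Proof.
move=> ind; apply: (frl_adjoin Qdiv (alg_indep2_transc ind)) => p p0 l.
pose n := maxn r (\max_i size (p i)).
have lern : (r <= n)%N by apply: leq_maxl.
have sn i : (size (p i) <= n)%N.
  by apply: leq_trans (leq_maxr _ _); apply: (leq_bigmax (F := fun i => size (p i))).
pose cf (i j : nat) : K := if insub j is Some j' then (p (j' : 'I_r))`_i else 0.
have c0 : forall i j : 'I_n, cf i j = 0.
  apply: ind; rewrite exchange_big -[RHS]p0 /=.
  have E (j : 'I_r) : horner_alg x (p j) * y ^+ j = \sum_(i < n) cf i j *: (x ^+ i * y ^+ j).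
    rewrite (horner_algE _ (sn j)) mulr_suml; apply: eq_bigr => i _.
    by rewrite /cf valK scalerAl.
  under [RHS]eq_bigr => j _ do rewrite E.
  rewrite [RHS](big_ord_widen _ (fun j => \sum_(i < n) cf i j *: (x ^+ i * y ^+ j)) lern).
  rewrite [RHS]big_mkcond /=; apply: eq_bigr => j _; case: ifP => // nj.
  by rewrite big1 // => i _; rewrite /cf insubF ?nj // scale0r.
apply/polyP => i; rewrite coef0; have [lti|lei] := ltnP i n; last first.
  by rewrite nth_default // (leq_trans (sn l)).
by have := c0 (Ordinal lti) (widen_ord lern l); rewrite /cf /= valK.
Qed.

End Conclusions.

Section Assembly.
Variables (K : closedFieldType) (Q : unitAlgType K).
Hypothesis Qdiv : forall x : Q, x != 0 -> x \is a GRing.unit.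

(** This is [centre_fdim] for the whole of [Q], with [D] as the commutative subalgebra. *)
Lemma left_findim_centre (D : {pred Q}) :
  divalg_closed D -> commutative_set D -> left_findim D -> left_findim (centre (K:=K) (Q:=Q)).
Proof.
move=> Dcl Dcomm [b bP].
have Qcl : divalg_closed (predT : {pred Q}) by split.
have spb q : spn D (fun i : 'I_(size b) => b`_i) q.
  have [c [cD ->]] := bP q; exists (fun i : 'I_(size b) => c`_i); split=> // i.
  have [lti|lei] := ltnP i (size c); first exact: (allP cD _ (mem_nth 0 lti)).
  by rewrite nth_default // (divring0 Dcl).
have [n _ dn] := fdim_spanned Qdiv Dcl (X := fun x => x \in predT) (fun q _ => spb q).
have [r _ [v [_ _ vs]]] := centre_fdim Qdiv Qcl Dcl (fun _ _ => isT) Dcomm dn.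
apply: (left_findim_spn (S := centre (K:=K) (Q:=Q)) (w := v)) => q.
apply: (spn_scalars _ (vs q isT)) => c /centzP[_ cc].
by apply/asboolP => w; apply: cc.
Qed.

End Assembly.

(* Consequences of GK dimension below 3, and the conclusion *)
From mathcomp Require Import classical_sets reals ereal sequences exp Rstruct.

(** Otherwise f(m + c) / f(m) > 1 + 15 c / m >= (1 + c / m)^4 for all large m, so f(m) / m^4 would
    not decrease along a progression of difference c, and f would outgrow n^3. *)
Lemma slow_growth (f : nat -> nat) (c N : nat) :
  (forall n, (0 < f n)%N) -> (exists n0, forall n, (n0 <= n)%N -> (f n <= n ^ 3)%N) ->
  exists2 m, (N <= m)%N & (m * (f (m + c) - f m) <= 15 * c * f m)%N.
Proof.
move=> f0 [n0 fn]; apply: contrapT => H.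
have [c0|c0] := posnP c; first by apply: H; exists N; rewrite // c0 addn0 subnn muln0.
(* Starting at N + c ensures both m >= N and c / m <= 1. *)
pose N1 := (N + c)%N.
have step m : (N1 <= m)%N -> (f m * (m + c) ^ 4 <= f (m + c) * m ^ 4)%N.
  move=> lem; have ltm : (15 * c * f m < m * (f (m + c) - f m))%N.
    by rewrite ltnNge; apply/negP => le; apply: H; exists m => //; rewrite /N1 in lem; lia.
  have lemc : (c <= m)%N by rewrite /N1 in lem; lia.
  have h1 : ((m + 15 * c) * f m <= m * f (m + c))%N by nia.
  have h2 : ((m + c) ^ 4 <= m ^ 3 * (m + 15 * c))%N.
    have h3 : (c ^ 2 <= m * c)%N by nia.
    have h4 : (m * c ^ 2 <= m ^ 2 * c)%N by nia.
    have h5 : (c ^ 3 <= m ^ 2 * c)%N by nia.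
    nia.
  apply: (@leq_trans (f m * (m ^ 3 * (m + 15 * c)))); first by rewrite leq_mul2l h2 orbT.
  have -> : (f m * (m ^ 3 * (m + 15 * c)) = m ^ 3 * ((m + 15 * c) * f m))%N by lia.
  have -> : (f (m + c) * m ^ 4 = m ^ 3 * (m * f (m + c)))%N by rewrite (expnS m 3); lia.
  by rewrite leq_mul2l h1 orbT.
have it j : (f N1 * (N1 + j * c) ^ 4 <= f (N1 + j * c) * N1 ^ 4)%N.
  elim: j => [|j IH]; first by rewrite mul0n addn0.
  set m := (N1 + j * c)%N in IH *; have lem : (N1 <= m)%N by apply: leq_addr.
  have m0 : (0 < m ^ 4)%N by rewrite expn_gt0 (leq_trans _ lem) // /N1; lia.
  have -> : (N1 + j.+1 * c = m + c)%N by rewrite /m; lia.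
  rewrite -(leq_pmul2r m0) mulnAC.
  apply: (@leq_trans (f m * N1 ^ 4 * (m + c) ^ 4)); first by rewrite leq_mul2r IH orbT.
  by rewrite mulnAC [X in (_ <= X)%N]mulnAC leq_mul2r step ?orbT.
(* Far enough for the cubic bound to hold and for m > N1^4, which contradicts m^4 <= m^3 N1^4. *)
pose j := (n0 + N1 ^ 4)%N; pose m := (N1 + j * c)%N.
have jc : (j <= j * c)%N by rewrite leq_pmulr.
have jm : (j < m)%N by rewrite /m /N1; move: (j * c)%N jc => k; lia.
have h1 : (m ^ 4 <= m ^ 3 * N1 ^ 4)%N.
  apply: (leq_trans _ (leq_trans (it j) _)); first by rewrite leq_pmull.
  by rewrite leq_mul2r fn ?orbT // /j in jm *; lia.
have m3 : (0 < m ^ 3)%N by rewrite expn_gt0; lia.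
by move: h1; rewrite expnSr leq_pmul2l //; rewrite /j in jm; lia.
Qed.

Section Growth.
Variables (K : fieldType) (Q : unitAlgType K) (s : seq Q).
Hypothesis Qdiv : forall x : Q, x != 0 -> x \is a GRing.unit.
Local Notation d := (fun n => span_dim (words s n)).

(** The strict inequality leaves a margin: d(n) <= n^r eventually, for some r < 3, and n^(3 - r)
    exceeds any given [M]. *)
Lemma GKdim_lt3 : (GKdim_gen s < 3%:E)%E ->
  forall M : nat, exists n0, forall n, (n0 <= n)%N -> (M * d n <= n ^ 3)%N.
Proof.
rewrite /GKdim_gen limn_esup_lim; set u := (fun n => _).
rewrite (cvg_lim _ (@cvg_esups_inf _ u)) // => /ereal_inf_lt[_ [n0 _ <-]] lt3 M.
have [r r3 ur] : exists2 r : Rdefinitions.R, r < 3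
    & forall n, (n0 <= n)%N -> ln (d n)%:R / ln n%:R <= r :> Rdefinitions.R.
  have le_u n : (n0 <= n)%N -> (u n <= esups u n0)%E.
    by move=> le; apply: ereal_sup_ubound; exists n.
  have := le_u n0 (leqnn _); case: (esups u n0) lt3 le_u => [r| |] //.
  rewrite lte_fin => r3 le_u _; exists r => // n /le_u.
(* From [B] on, ln M <= (3 - r) ln n. *)
pose B := Num.bound (expR (ln M%:R / (3 - r))).
exists (n0 + B + 2)%N => n len.
have n0n : (n0 <= n)%N by lia.
have n2 : (1 < n)%N by lia.
have Bn : (B <= n)%N by lia.
have [->|M0] := posnP M; first by rewrite mul0n.
have lnn : 0 < ln n%:R :> Rdefinitions.R by rewrite ln_gt0 // ltr1n.
have := ur n n0n; rewrite ler_pdivrMr // => dn.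
rewrite -(ler_nat Rdefinitions.R) natrM natrX -ler_ln ?posrE; last 2 first.
- by rewrite mulr_gt0 ?ltr0n // filt_dim_gt0.
- by rewrite exprn_gt0 // ltr0n; lia.
rewrite lnM ?posrE ?ltr0n ?filt_dim_gt0 // lnXn ?ltr0n; last by lia.
have : ln M%:R / (3 - r) <= ln n%:R.
  rewrite -[leLHS]expRK ler_ln ?posrE ?expR_gt0 ?ltr0n //; last by lia.
  apply: ltW; apply: lt_le_trans (archi_boundP _) _; first exact: expR_ge0.
  by rewrite ler_nat.
rewrite ler_pdivrMr ?subr_gt0 // => Mn.
have key (F : realFieldType) (a b l t : F) : b <= t * l -> a <= l * (3 - t) -> a + b <= 3 * l.
  by move=> h1 h2; nra.
by rewrite -[leRHS]mulr_natl; apply: key dn Mn.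
Qed.

End Growth.

Theorem theorem1p4 (K : closedFieldType) (Q : unitAlgType K)
  (Qdiv : forall x : Q, x != 0 -> x \is a GRing.unit)
  (s : seq Q)
  (GK3 : (GKdim_gen s < 3%:E)%E)
  (QA : is_quotient_ring (gen_alg s))
  (D : {pred Q}) (Dsub : divalg_closed D) :
  (commutative_set D \/ left_findim D) /\
  (commutative_set D -> trdeg_ge2 D -> left_findim (centre (K:=K) (Q:=Q))).
Proof.
have cubic := GKdim_lt3 Qdiv GK3.
have slow c N : exists2 m, (N <= m)%N &
    (m * (span_dim (words s (m + c)) - span_dim (words s m)) <= 15 * c * span_dim (words s m))%N.
  apply: (slow_growth (f := fun n => span_dim (words s n)) c N) => [n|].
    exact: filt_dim_gt0.
  by have [n0 n0P] := cubic 1%N; exists n0 => n /n0P; rewrite mul1n.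
split=> [|Dcomm [x [y [Dx Dy ind]]]].
  have [Dcomm|ncomm] := EM (commutative_set D); [by left|right].
  have [a [b [Da Db ab]]] : exists a b, [/\ a \in D, b \in D & a * b != b * a].
    apply: contrapT => H; apply: ncomm => a b Da Db; apply: contrapT => /eqP ab.
    by apply: H; exists a, b.
  have ta := noncomm_transc Qdiv ab.
  have b0 : b != 0 by apply: contraNneq ab => ->; rewrite mulr0 mul0r.
  have [[W [WD trees]]|[D0 [D0cl D0a D0b [n D0n]]]] := tree_dichotomy Qdiv Dsub Da Db ta b0.
    exact: (trees_left_findim Qdiv slow cubic QA Dsub Da ta WD trees).
  by case/eqP: ab; apply: (finite_over_adjoin_commutative Qdiv ta D0cl D0a D0n).
apply: (left_findim_centre Qdiv Dsub Dcomm).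
apply: (trees_left_findim Qdiv slow cubic QA Dsub Dx (alg_indep2_transc ind) (W := [:: y])).
  by move=> w; rewrite inE => /eqP->.
move=> r r0; exists r, (fun j => y ^+ j), (fun i => i); split=> //; first by rewrite leq_pmull.
  split=> // j _; exists y, j; by rewrite inE eqxx exprS.
exact: (alg_indep2_free Qdiv ind).
Qed.
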